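(* Let $X^{(1)},\dots,X^{(n)}$ be i.i.d. $\mathcal N(0,\Sigma^* )$ in $\mathbb R^d$. Suppose that Assumptions 1, 2 and 3 (stated in the context) hold, that $n\gtrsim s\log d$, take $\lambda$ such that $\lambda\asymp\sqrt{\log d/n}$ (with suitably chosen constant), and let $T\gtrsim\log(\lambda\sqrt n)\gtrsim\log\log d$. Then $\widetilde\Theta^{(T)}=\widehat W^{-1}\widehat\Psi^{(T)}\widehat W^{-1}$ satisfies $$\big\|\widetilde\Theta^{(T)}-\Theta^*\big\|_2=\mathcal O_{\mathbb P}\Big(\sqrt{\frac sn}\vee\sqrt{\frac{\log d}{n}}\Big).$$
   Context: Notation. $\|\cdot\|_2$ is the spectral norm, $\|\cdot\|_\infty$ the $\ell_\infty\to\ell_\infty$ operator norm (maximum absolute row sum), $\langle A,B\rangle=\mathrm{tr}(A^{\mathrm T}B)$, $\odot$ the Hadamard product, $\|A\|_{1,\mathrm{off}}=\sum_{i\ne j}|A_{ij}|$, $a\vee b=\max\{a,b\}$. $\mathcal S_+^d$ is the set of symmetric positive definite $d\times d$ matrices. Model. $\Sigma^*$ is positive definite, $\Theta^*=(\Sigma^* )^{-1}$, $W^2=\mathrm{diag}(\Sigma^* )$ (diagonal part), $C^*=W^{-1}\Sigma^*W^{-1}$ is the correlation matrix and $\Psi^*=(C^* )^{-1}$. $S=\{(i,j):i\ne j,\ \Theta^*_{ij}\ne0\}$, which is also the off-diagonal support of $\Psi^*$. Estimators. $\widehat\Sigma=n^{-1}\sum_{i=1}^n X^{(i)}(X^{(i)})^{\mathrm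 T}$, $\widehat W^2=\mathrm{diag}(\widehat\Sigma)$, $\widehat C=\widehat W^{-1}\widehat\Sigma\widehat W^{-1}$. Given $\lambda>0$ and a weight function $\mathrm w$, put $\widehat\Psi^{(0)}=0$, so that $\lambda^{(0)}_{ij}=\lambda$ for $i\neq j$, and for $\ell=1,\dots,T$ $$\widehat\Psi^{(\ell)}=\operatorname*{argmin}_{\Psi\in\mathcal S_+^d}\big\{\langle\Psi,\widehat C\rangle-\log\det\Psi+\|\lambda^{(\ell-1)}\odot\Psi\|_{1,\mathrm{off}}\big\},\qquad \lambda^{(\ell)}_{ij}=\lambda\,\mathrm w\big(|\widehat\Psi^{(\ell)}_{ij}|\big)\ (i\ne j).$$ Assumptions. Let $c=2\big(32\|\Psi^*\|_2^2+\|\Sigma^*\|_\infty^2\vee1\big)$ and $u=c\lambda$. Assumption 1: $|S|\le s$, $\|\Sigma^*\|_\infty\le M<\infty$, $0<\varepsilon_1\le\sigma_{\min}\le\sigma_{\max}\le1/\varepsilon_1<\infty$, and $0<\varepsilon_2\le\lambda_{\min}(\Theta^* )\le\lambda_{\max}(\Theta^* )\le1/\varepsilon_2<\infty$, where $\sigma_{\max}^2=\max_j\Sigma^*_{jj}$, $\sigma_{\min}^2=\min_j\Sigma^*_{jj}$ and $\lambda_{\min},\lambda_{\max}$ are extreme eigenvalues. $M,\varepsilon_1,\varepsilon_2$ are treated as constants. Assumption 2: $\mathrm w:\mathbb R\to\mathbb R$ is nonincreasing, $0\le\mathrm w(t)\le1$ for $t\ge0$, $\mathrm w(t)=1$ for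 $t\le0$; there is a constant $\alpha$ with $\mathrm w(\alpha\lambda)=0$; and $\mathrm w(u)\ge1/2$. Assumption 3: $\min_{(i,j)\in S}|\Psi^*_{ij}|\ge(\alpha+c)\lambda$. Asymptotic conventions. $f\gtrsim g$ (resp. $f\lesssim g$) means $f\ge kg$ (resp. $f\le kg$) for a positive constant $k$; $f\asymp g$ means both. Constants do not depend on $n,d,s$ (they may depend on $M,\varepsilon_1,\varepsilon_2,\alpha$), and in sample size conditions and in lower bounds on $T$ the constant is sufficiently large. $Y_n=\mathcal O_{\mathbb P}(a_n)$ means $Y_n/a_n$ is bounded in probability as $n,d\to\infty$, where $d,s$ may grow with $n$. *)

(* Defs.v *)
From HB Require Import structures.
From mathcomp Require Import all_boot all_order all_algebra.
From mathcomp Require Import all_classical all_reals all_analysis.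

Set Implicit Arguments.
Unset Strict Implicit.
Unset Printing Implicit Defensive.

Import Order.TTheory GRing.Theory Num.Theory.
Import numFieldNormedType.Exports.

Local Open Scope classical_set_scope.
Local Open Scope ring_scope.

Section matrices.
Context {R : realType} {d : nat}.
Implicit Types (A B : 'M[R]_d) (x : 'cV[R]_d).

Definition l2norm x : R := Num.sqrt (\sum_i x i 0 ^+ 2).

Definition spectral_norm A : R :=
  sup [set l2norm (A *m x) | x in [set x | l2norm x = 1]].

Definition linf_norm A : R := \big[Num.max/0]_i \sum_j `|A i j|.

Definition inner A B : R := \tr (A^T *m B).

Definition hadamard A B : 'M[R]_d := map2_mx *%R A B.

Definition l1off_norm A : R := \sum_i \sum_(j | j != i) `|A i j|.

Definition posdef A : Prop :=
  A^T = A /\ forall x, x != 0 -> 0 < (x^T *m A *m x) 0 0.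

Definition lambda_min A : R := inf [set a | eigenvalue A a].
Definition lambda_max A : R := sup [set a | eigenvalue A a].

Definition sigma_min A : R := Num.sqrt (inf (range (fun j => A j j))).
Definition sigma_max A : R := Num.sqrt (sup (range (fun j => A j j))).

(* W, where W^2 is the diagonal part of A *)
Definition std_mx A : 'M[R]_d := diag_mx (\row_j Num.sqrt (A j j)).

Definition corr_mx A : 'M[R]_d := invmx (std_mx A) *m A *m invmx (std_mx A).

Definition off_support A : {set 'I_d * 'I_d} :=
  [set ij | (ij.1 != ij.2) && (A ij.1 ij.2 != 0)]%SET.

End matrices.

Section estimators.
Context {R : realType} {d : nat}.
Implicit Types (C L Psi A : 'M[R]_d) (w : R -> R) (lambda : R).

(* A minimizer of f over D; the default value 0 is returned when there is no
   minimizer. *)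
Definition argmin (D : set 'M[R]_d) (f : 'M[R]_d -> R) : 'M[R]_d :=
  xget 0 [set A | D A /\ forall B, D B -> f A <= f B].

Definition glasso_loss C L Psi : R :=
  inner Psi C - ln (\det Psi) + l1off_norm (hadamard L Psi).

(* The diagonal entries are irrelevant, by the definition of l1off_norm. *)
Definition weights w lambda Psi : 'M[R]_d :=
  \matrix_(i, j) (if i == j then 0 else lambda * w `|Psi i j|).

Fixpoint psi_hat w lambda C (l : nat) : 'M[R]_d :=
  if l is m.+1 then
    argmin posdef (glasso_loss C (weights w lambda (psi_hat w lambda C m)))
  else 0.

Definition theta_tilde w lambda (S : 'M[R]_d) (T : nat) : 'M[R]_d :=
  invmx (std_mx S) *m psi_hat w lambda (corr_mx S) T *m invmx (std_mx S).

End estimators.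

Section assumptions.
Context {R : realType} {d : nat}.
Implicit Types (Sigma : 'M[R]_d) (w : R -> R).

Definition theta_star Sigma : 'M[R]_d := invmx Sigma.
Definition psi_star Sigma : 'M[R]_d := invmx (corr_mx Sigma).

Definition c_const Sigma : R :=
  2 * (32 * spectral_norm (psi_star Sigma) ^+ 2
       + Num.max (linf_norm Sigma ^+ 2) 1).

Definition assumption1 (M eps1 eps2 : R) (s : nat) Sigma : Prop :=
  [/\ (#|off_support (theta_star Sigma)| <= s)%N,
      linf_norm Sigma <= M,
      [/\ 0 < eps1, eps1 <= sigma_min Sigma,
          sigma_min Sigma <= sigma_max Sigma & sigma_max Sigma <= eps1^-1] &
      [/\ 0 < eps2, eps2 <= lambda_min (theta_star Sigma),
          lambda_min (theta_star Sigma) <= lambda_max (theta_star Sigma) &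
          lambda_max (theta_star Sigma) <= eps2^-1]].

Definition assumption2 (alpha lambda : R) w Sigma : Prop :=
  [/\ {homo w : x y /~ x <= y},
      forall t, 0 <= t -> 0 <= w t <= 1,
      forall t, t <= 0 -> w t = 1,
      w (alpha * lambda) = 0 &
      2^-1 <= w (c_const Sigma * lambda)].

Definition assumption3 (alpha lambda : R) Sigma : Prop :=
  forall i j, (i, j) \in off_support (theta_star Sigma) ->
    (alpha + c_const Sigma) * lambda <= `|psi_star Sigma i j|.

End assumptions.

Section sampling.
Context {R : realType} {disp : measure_display} {Omega : measurableType disp}.
Context (P : probability Omega R) {n d : nat}.

(* Centered Gaussian vector: every linear combination of the coordinates is
   normal.  The second parameter of normal_prob is the standard deviation; a = 0
   is left out because normal_prob m 0 is not a Dirac measure. *)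
Definition gaussian_vector (Y : 'I_d -> {RV P >-> R}) (Sigma : 'M[R]_d) : Prop :=
  forall a : 'cV[R]_d, a != 0 -> forall B : set R, measurable B ->
    P ((fun omega => \sum_j a j 0 * Y j omega) @^-1` B) =
    normal_prob 0 (Num.sqrt ((a^T *m Sigma *m a) 0 0)) B.

(* Independence of the sigma-algebras generated by the random vectors X i. *)
Definition independent_vectors (X : 'I_n -> 'I_d -> {RV P >-> R}) : Prop :=
  forall (J : {set 'I_n}) (E : 'I_n -> set Omega),
    (forall i, i \in J -> g_sigma_preimage (fun j => X i j : Omega -> R) (E i)) ->
    P (\bigcap_(i in [set` J]) E i) = (\prod_(i in J) P (E i))%E.

Definition iid_gaussian (X : 'I_n -> 'I_d -> {RV P >-> R}) (Sigma : 'M[R]_d)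
    : Prop :=
  (forall i, gaussian_vector (X i) Sigma) /\ independent_vectors X.

Definition sigma_hat (X : 'I_n -> 'I_d -> {RV P >-> R}) (omega : Omega)
    : 'M[R]_d :=
  let x i : 'cV[R]_d := \col_j X i j omega in
  n%:R^-1 *: \sum_i (x i *m (x i)^T).

End sampling.

Section asymptotics.
Context {R : realType}.

Definition gtrsim_with (k : R) (f g : nat -> R) : Prop :=
  \forall n \near \oo, k * g n <= f n.

Definition gtrsim (f g : nat -> R) : Prop := exists2 k, 0 < k & gtrsim_with k f g.

(* Y n / a n is bounded in probability.  The exceedance event is covered by a
   measurable set of small probability, i.e. its outer probability is small, so
   that measurability of Y n need not be assumed. *)
Definition bigO_prob (disp : nat -> measure_display)
    (Omega : forall n, measurableType (disp n))
    (P : forall n, probability (Omega n) R)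
    (Y : forall n, Omega n -> R) (a : nat -> R) : Prop :=
  forall delta : R, 0 < delta -> exists2 K : R, 0 < K &
    \forall n \near \oo, exists B : set (Omega n),
      [/\ measurable B, (P n B <= delta%:E)%E &
          [set omega | K < `|Y n omega / a n|] `<=` B].

End asymptotics.

(* Main.v *)
Require Import Defs.
From HB Require Import structures.
From mathcomp Require Import all_boot all_order all_algebra.
From mathcomp Require Import all_classical all_reals all_analysis.
From mathcomp Require Import measurable_realfun.
From mathcomp Require Import ring lra.

(* For positive definite A and B, if A is bounded by a multiple of B and B by
   b, then ln det A lies below its tangent at B by a multiple of
   |A - B|_F^2 / b^2; this is proved by Gaussian elimination from the scalar
   inequality for ln.  Write Psi0 and C0 for the true Psi and C.  The excess of
   the graphical lasso loss over its value at Psi0 is at least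
   |Psi - Psi0|_F^2 / (8 |Psi0|^2) minus terms linear in Psi - Psi0 and, the
   loss being convex, every minimizer is within
     8 |Psi0|^2 (|(Chat - C0)_S|_F + |D|_F)
   of Psi0, where D dominates the penalty left on S and the noise at the entries
   off S that are penalized by less than lambda / 2.  By assumptions 2 and 3
   such an entry, or a penalized entry of S, has an error of more than c lambda
   in the previous iterate P, so that D = |P - Psi0| / c works, and the choice of
   c makes the error contract by a factor 1/8 up to the noise restricted to S.
   After T >= ln (lambda sqrt n) / ln 8 steps only that noise is left.

   The noise is controlled through the quadratic forms a^T (Sigmahat - Sigma) a,
   whose moment generating functions are explicit for Gaussian data; finitely
   many directions a recover all entries of Chat by polarization.  Chernoff
   bounds and a union bound give max |Chat - C0| <= lambda / 2, while second
   moments, summed over S, give |(Chat - C0)_S|_F = O_P (sqrt (s / n)), with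
   no logarithm. *)

Set Implicit Arguments.
Unset Strict Implicit.
Unset Printing Implicit Defensive.

Import Order.TTheory GRing.Theory Num.Theory.
Import numFieldNormedType.Exports.

Local Open Scope classical_set_scope.
Local Open Scope ring_scope.

(** * Quadratic forms and the log-determinant *)

Section frobenius.
Context {R : realType}.

(** The two terms of the rate have different origins. The error of Psi is measured in Frobenius norm
    and costs [sqrt (s / n)]: the diagonal of [Chat] is exactly 1, so only off-diagonal noise enters
    it. Rescaling by [What^-1] multiplies by diagonal matrices, whose spectral norm is their largest
    entry, so the variances cost only a maximum over coordinates, of order [sqrt (log d / n)].

    The main obstacle is that nothing guarantees a minimizer in advance: [Chat] is singular when
    [d > n], and [argmin] then could be the default value 0. Moreover the quadratic lower bound on
    the excess loss is local, valid for [A <= 2 Psi0]. Hence every step needs its radius known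
    beforehand to be smaller than the least eigenvalue of [Psi0]. This is why a crude bound
    [c lambda sqrt s] on the error is carried along with the sharp one; the condition on [n] serves
    to make [lambda sqrt s] small. *)

Definition fro2 {m n} (A : 'M[R]_(m, n)) : R := \sum_i \sum_j A i j ^+ 2.

Definition qform {n} (A : 'M[R]_n) (x : 'cV[R]_n) : R := (x^T *m A *m x) 0 0.

Lemma fro2_ge0 m n (A : 'M[R]_(m, n)) : 0 <= fro2 A.
Proof. by do 2!apply: sumr_ge0 => ? _; exact: sqr_ge0. Qed.

Lemma fro2_trace m n (A : 'M[R]_(m, n)) : fro2 A = \tr (A^T *m A).
Proof.
rewrite /fro2 exchange_big; apply: eq_bigr => j _; rewrite mxE.
by apply: eq_bigr => i _; rewrite mxE expr2.
Qed.

Lemma fro2_tr m n (A : 'M[R]_(m, n)) : fro2 A^T = fro2 A.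
Proof. by rewrite !fro2_trace trmxK mxtrace_mulC. Qed.

Lemma fro2_vec n (x : 'cV[R]_n) : fro2 x = (x^T *m x) 0 0.
Proof. by rewrite fro2_trace /mxtrace big_ord1. Qed.

Lemma l2normE n (x : 'cV[R]_n) : l2norm x = Num.sqrt (fro2 x).
Proof. by rewrite /l2norm /fro2; under [in RHS]eq_bigr do rewrite big_ord1. Qed.

Lemma fro2_eq0 m n (A : 'M[R]_(m, n)) : (fro2 A == 0) = (A == 0).
Proof.
apply/eqP/eqP => [A0|->]; last first.
  by rewrite /fro2 big1// => i _; rewrite big1// => j _; rewrite mxE expr0n.
apply/matrixP => i j; rewrite mxE; apply/eqP; rewrite -sqrf_eq0; apply/eqP.
have /psumr_eq0P := A0 => /(_ (fun i _ => sumr_ge0 _ (fun j _ => sqr_ge0 _))).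
by move=> /(_ i isT)/psumr_eq0P -> // k _; exact: sqr_ge0.
Qed.

Lemma fro2_gt0 m n (A : 'M[R]_(m, n)) : A != 0 -> 0 < fro2 A.
Proof. by move=> A0; rewrite lt_neqAle fro2_ge0 andbT eq_sym fro2_eq0. Qed.

Lemma fro2Z m n a (A : 'M[R]_(m, n)) : fro2 (a *: A) = a ^+ 2 * fro2 A.
Proof.
rewrite /fro2 mulr_sumr; apply: eq_bigr => i _; rewrite mulr_sumr.
by apply: eq_bigr => j _; rewrite mxE exprMn.
Qed.

Lemma fro2_col m n (A : 'M[R]_(m, n)) : fro2 A = \sum_j fro2 (col j A).
Proof.
rewrite /fro2 exchange_big; apply: eq_bigr => j _; apply: eq_bigr => i _.
by rewrite big_ord1 mxE.
Qed.

Lemma fro2_block m1 m2 n1 n2 (A : 'M[R]_(m1, n1)) (B : 'M[R]_(m1, n2))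
    (C : 'M[R]_(m2, n1)) (D : 'M[R]_(m2, n2)) :
  fro2 (block_mx A B C D) = fro2 A + fro2 B + fro2 C + fro2 D.
Proof.
rewrite /fro2 big_split_ord/= -addrA -[in RHS]addrA.
under eq_bigr => i _.
  rewrite big_split_ord/=.
  under eq_bigr do rewrite block_mxEul.
  under [X in _ + X]eq_bigr do rewrite block_mxEur.
  over.
rewrite big_split/= -!addrA; congr (_ + (_ + _)).
under eq_bigr => i _.
  rewrite big_split_ord/=.
  under eq_bigr do rewrite block_mxEdl.
  under [X in _ + X]eq_bigr do rewrite block_mxEdr.
  over.
by rewrite big_split/=.
Qed.

Lemma fro2_1 (a : R) : fro2 (a%:M : 'M[R]_1) = a ^+ 2.
Proof. by rewrite /fro2 !big_ord1 mxE eqxx mulr1n. Qed.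

Lemma sum_cauchy_schwarz (I : finType) (P : pred I) (a b : I -> R) :
  (\sum_(i | P i) a i * b i) ^+ 2
    <= (\sum_(i | P i) a i ^+ 2) * (\sum_(i | P i) b i ^+ 2).
Proof.
rewrite -subr_ge0.
have : 0 <= \sum_(i | P i) \sum_(j | P j) (a i * b j - a j * b i) ^+ 2.
  by do 2!apply: sumr_ge0 => ? _; exact: sqr_ge0.
have -> : \sum_(i | P i) \sum_(j | P j) (a i * b j - a j * b i) ^+ 2 =
    (\sum_(i | P i) a i ^+ 2) * (\sum_(i | P i) b i ^+ 2) *+ 2
    - (\sum_(i | P i) a i * b i) ^+ 2 *+ 2.
  rewrite expr2 !big_distrlr/= mulr2n.
  rewrite [X in _ + X - _]exchange_big/= -!sumrMnl -big_split/= -sumrB.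
  apply: eq_bigr => i _; rewrite -!sumrMnl -big_split/= -sumrB.
  by apply: eq_bigr => j _; ring.
by rewrite -mulrnBl pmulrn_lge0.
Qed.

Lemma fro2_cauchy_schwarz m n (A B : 'M[R]_(m, n)) :
  (\sum_i \sum_j A i j * B i j) ^+ 2 <= fro2 A * fro2 B.
Proof. by rewrite /fro2 !pair_big/=; exact: sum_cauchy_schwarz. Qed.

Lemma sum_mul_le_fro m n (A B : 'M[R]_(m, n)) :
  \sum_i \sum_j A i j * B i j <= Num.sqrt (fro2 A) * Num.sqrt (fro2 B).
Proof.
rewrite -sqrtrM ?fro2_ge0//; apply: le_trans (ler_norm _) _.
by rewrite -sqrtr_sqr ler_wsqrtr// fro2_cauchy_schwarz.
Qed.

Lemma fro_triangle m n (A B : 'M[R]_(m, n)) :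
  Num.sqrt (fro2 (A + B)) <= Num.sqrt (fro2 A) + Num.sqrt (fro2 B).
Proof.
have h : fro2 (A + B) = fro2 A + fro2 B + 2 * \sum_i \sum_j A i j * B i j.
  rewrite /fro2 mulr_sumr -!big_split/=; apply: eq_bigr => i _.
  rewrite mulr_sumr -!big_split/=; apply: eq_bigr => j _.
  by rewrite mxE; ring.
rewrite -ler_sqr ?nnegrE ?addr_ge0 ?sqrtr_ge0// sqr_sqrtr ?fro2_ge0//.
rewrite sqrrD !sqr_sqrtr ?fro2_ge0// h.
have := sum_mul_le_fro A B; lra.
Qed.

Lemma fro2_mulmx m n p (A : 'M[R]_(m, n)) (B : 'M[R]_(n, p)) :
  fro2 (A *m B) <= fro2 A * fro2 B.
Proof.
rewrite /fro2 [X in _ * X]exchange_big/= mulr_suml; apply: ler_sum => i _.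
rewrite mulr_sumr; apply: ler_sum => j _; rewrite mxE.
exact: sum_cauchy_schwarz.
Qed.

Lemma qform_scalar n (a : R) (x : 'cV[R]_n) : qform a%:M x = a * fro2 x.
Proof. by rewrite /qform mul_mx_scalar -scalemxAl mxE fro2_vec. Qed.

Lemma qformD n (A B : 'M[R]_n) x : qform (A + B) x = qform A x + qform B x.
Proof. by rewrite /qform mulmxDr mulmxDl mxE. Qed.

Lemma qformN n (A : 'M[R]_n) x : qform (- A) x = - qform A x.
Proof. by rewrite /qform mulmxN mulNmx mxE. Qed.

Lemma qformB n (A B : 'M[R]_n) x : qform (A - B) x = qform A x - qform B x.
Proof. by rewrite qformD qformN. Qed.

Lemma qformZ n a (A : 'M[R]_n) x : qform (a *: A) x = a * qform A x.
Proof. by rewrite /qform -scalemxAr -scalemxAl mxE. Qed.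

Lemma qformZv n a (A : 'M[R]_n) x : qform A (a *: x) = a ^+ 2 * qform A x.
Proof.
rewrite /qform (_ : (a *: x)^T = a *: x^T); last by rewrite linearZ.
by rewrite -scalemxAr -!scalemxAl scalerA mxE expr2.
Qed.

Lemma qform_congr m n (A : 'M[R]_n) (L : 'M[R]_(n, m)) (x : 'cV[R]_m) :
  (x^T *m (L^T *m A *m L) *m x) 0 0 = qform A (L *m x).
Proof. by rewrite /qform trmx_mul !mulmxA. Qed.

Lemma qform_gram m n (L : 'M[R]_(n, m)) x : qform (L *m L^T) x = fro2 (L^T *m x).
Proof. by rewrite /qform fro2_vec trmx_mul trmxK !mulmxA. Qed.

Lemma qform_outer n (v y : 'cV[R]_n) :
  qform (v *m v^T) y = (v^T *m y) 0 0 ^+ 2.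
Proof. by rewrite qform_gram /fro2 !big_ord1. Qed.

Lemma qform_fro_le n (A : 'M[R]_n) x :
  `|qform A x| <= Num.sqrt (fro2 A) * fro2 x.
Proof.
rewrite -(@ger0_norm _ (_ * fro2 x)) ?mulr_ge0 ?sqrtr_ge0 ?fro2_ge0//.
rewrite -ler_sqr ?nnegrE// !real_normK ?num_real//.
rewrite exprMn sqr_sqrtr ?fro2_ge0//.
rewrite /qform -mulmxA.
have -> : (x^T *m (A *m x)) 0 0 = \sum_i \sum_j x i j * (A *m x) i j.
  by rewrite mxE; apply: eq_bigr => i _; rewrite big_ord1 mxE.
apply: le_trans (fro2_cauchy_schwarz _ _) _.
by rewrite mulrC expr2 mulrA ler_wpM2r ?fro2_ge0// fro2_mulmx.
Qed.

End frobenius.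

(** * Schur complements, the log-determinant, extreme eigenvalues and the spectral norm *)

Section positive_definite.
Context {R : realType}.

Lemma posdef_qform n (A : 'M[R]_n) x : posdef A -> x != 0 -> 0 < qform A x.
Proof. by move=> [_]; exact. Qed.

(** Completing the square: for fixed [y] the form is least at first coordinate [- a^-1 (v^T y)], and
    its value there is the form of the Schur complement at [y]. *)
Lemma posdef_block n (a : R) (v : 'cV[R]_n) (D : 'M[R]_n) :
  posdef (block_mx a%:M v^T v D) ->
  [/\ 0 < a & posdef (D - a^-1 *: (v *m v^T))].
Proof.
move=> [sA pA].
have qE (t : R) (y : 'cV[R]_n) :
    qform (block_mx a%:M v^T v D) (col_mx t%:M y) =
    a * t ^+ 2 + 2 * t * (v^T *m y) 0 0 + qform D y.
  rewrite /qform tr_col_mx mul_row_block mul_row_col tr_scalar_mx.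
  rewrite !mulmxDl !mul_mx_scalar !mul_scalar_mx.
  rewrite -!scalemxAl.
  have yv : (y^T *m v) 0 0 = (v^T *m y) 0 0.
    by rewrite -[in RHS](trmxK y) -trmx_mul [RHS]mxE.
  move: (y^T *m v) (v^T *m y) (_ *m y) yv => p q r yv.
  by rewrite !mxE yv eqxx/= mulr1n; ring.
have a0 : 0 < a.
  have := pA (col_mx 1%:M 0); rewrite -/(qform _ _) qE.
  rewrite /qform !mulmx0 !mxE expr1n !mulr0 !mulr1 !addr0; apply.
  apply/eqP => /matrixP/(_ (lshift n 0) 0).
  by rewrite col_mxEu !mxE eqxx => /eqP; rewrite oner_eq0.
split=> //; split.
  move: sA; rewrite tr_block_mx => /eq_block_mx[_ _ _ sD].
  by rewrite linearB linearZ/= trmx_mul trmxK sD.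
move=> y y0.
have := pA (col_mx (- (a^-1 * (v^T *m y) 0 0))%:M y).
rewrite -!/(qform _ _) qE qformB qformZ qform_outer.
have -> : col_mx (- (a^-1 * (v^T *m y) 0 0))%:M y != 0.
  by apply: contra_neq y0; rewrite -(@col_mx0 _ 1 n 1) => /eq_col_mx[].
move=> /(_ isT).
have an0 : a != 0 by rewrite gt_eqF.
set t := (v^T *m y) 0 0.
suff -> : qform D y - a^-1 * t ^+ 2 =
  a * (- (a^-1 * t)) ^+ 2 + 2 * - (a^-1 * t) * t + qform D y by [].
by field.
Qed.

Lemma posdef_block_split n (A : 'M[R]_(1 + n)) : posdef A ->
  A = block_mx (A 0 0)%:M (dlsubmx A)^T (dlsubmx A) (drsubmx A).
Proof.
move=> [sA _]; rewrite -[LHS]submxK; congr block_mx.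
- by apply/matrixP => i j; rewrite !ord1 !mxE eqxx; congr (A _ _); apply: val_inj.
- by rewrite trmx_dlsub sA.
Qed.

Lemma posdef_cholesky n (A : 'M[R]_n) : posdef A ->
  exists2 L : 'M[R]_n, L \in unitmx & A = L *m L^T.
Proof.
elim: n A => [A pA|n IH].
  by exists 1%:M; [exact: unitmx1|apply/matrixP => -[]].
rewrite -[n.+1]/(1 + n)%N => A pA.
have := pA; rewrite (posdef_block_split pA) {pA}.
move: (A 0 0) (dlsubmx A) (drsubmx A) => a v D pA.
have [a0 /IH[L uL LE]] := posdef_block pA.
exists (block_mx (Num.sqrt a)%:M 0 ((Num.sqrt a)^-1 *: v) L).
  by rewrite unitmxE det_lblock det_scalar1 unitrM -unitmxE uL unitfE gt_eqF ?sqrtr_gt0.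
have sa : Num.sqrt a != 0 by rewrite gt_eqF ?sqrtr_gt0.
rewrite tr_block_mx mulmx_block !linearZ/= trmx0 !mulmx0 !mul0mx !addr0.
rewrite tr_scalar_mx -LE; congr block_mx.
- by rewrite -scalar_mxM -expr2 sqr_sqrtr// ltW.
- by rewrite mul_scalar_mx scalerA mulVf// scale1r.
- by rewrite mul_mx_scalar scalerA divff// scale1r.
- rewrite -scalemxAl scalerA -invfM -expr2 sqr_sqrtr ?ltW//.
  by rewrite addrC subrK.
Qed.

Lemma gram_posdef n (L : 'M[R]_n) : L \in unitmx -> posdef (L *m L^T).
Proof.
move=> uL; split; first by rewrite trmx_mul trmxK.
move=> x x0; rewrite -/(qform _ _) qform_gram fro2_gt0//.
apply: contra_neq x0 => h; have uL' : L^T \in unitmx by rewrite unitmx_tr.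
by rewrite -(mulKmx uL' x) h mulmx0.
Qed.

Lemma posdef_det_gt0 n (A : 'M[R]_n) : posdef A -> 0 < \det A.
Proof.
move=> /posdef_cholesky[L uL ->]; rewrite det_mulmx det_tr -expr2.
by rewrite exprn_even_gt0//= -unitfE -unitmxE.
Qed.

Lemma posdef_unit n (A : 'M[R]_n) : posdef A -> A \in unitmx.
Proof. by move=> /posdef_det_gt0 A0; rewrite unitmxE unitfE gt_eqF. Qed.

(** A Cholesky factor replaces compactness of the sphere: [x = L^-T (L^T x)] bounds [|x|^2] by
    [|L^-T|_F^2] times the form. The added 1 keeps the constant positive in dimension 0. *)
Lemma posdef_gap n (A : 'M[R]_n) : posdef A ->
  exists2 e : R, 0 < e & forall x, e * fro2 x <= qform A x.
Proof.
move=> /posdef_cholesky[L uL ->].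
have uL' : L^T \in unitmx by rewrite unitmx_tr.
exists (1 + fro2 (invmx L^T))^-1; first by rewrite invr_gt0 ltr_pwDl ?fro2_ge0.
move=> x; rewrite qform_gram ler_pdivrMl ?ltr_pwDl ?fro2_ge0//.
rewrite -{1}(mulKmx uL' x); apply: le_trans (fro2_mulmx _ _) _.
by rewrite ler_wpM2r ?fro2_ge0// lerDr.
Qed.

(** With [b = sqrt a], [ln a = 2 ln b <= 2 (b - 1) = a - 1 - (b - 1)^2], while
    [k (a - 1)^2 = k (b + 1)^2 (b - 1)^2] and [k (b + 1)^2 <= 2 k (a + 1) <= 1]. *)
Lemma ln_quadratic_le (k a : R) : 0 <= k <= 4^-1 -> 0 < a -> 4 * k * a <= 1 ->
  ln a <= a - 1 - k * (a - 1) ^+ 2.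
Proof.
move=> /andP[k0 k4] a0 ka.
have b0 : 0 < Num.sqrt a by rewrite sqrtr_gt0.
have ab : a = Num.sqrt a ^+ 2 by rewrite sqr_sqrtr// ltW.
have : ln (Num.sqrt a) <= Num.sqrt a - 1.
  by rewrite -[in X in X <= _](subrKC 1 (Num.sqrt a)) le_ln1Dx// ltrBrDl subrr.
move: ab ka; set b := Num.sqrt a => ab; rewrite ab lnXn// => ka hb.
have h1 : k * (b + 1) ^+ 2 <= 1 by have := sqr_ge0 (b - 1); nra.
have h2 : k * (b ^+ 2 - 1) ^+ 2 <= (b - 1) ^+ 2.
  have -> : k * (b ^+ 2 - 1) ^+ 2 = k * (b + 1) ^+ 2 * (b - 1) ^+ 2 by ring.
  by rewrite ler_piMl ?sqr_ge0.
rewrite mulr2n; lra.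
Qed.

Lemma qform_block n (a : R) (v : 'cV[R]_n) (D : 'M[R]_n) (y : 'cV[R]_n) :
  qform (block_mx a%:M v^T v D) (col_mx 0 y) = qform D y.
Proof.
rewrite /qform tr_col_mx mul_row_block mul_row_col trmx0.
by rewrite mulmx0 !mul0mx !add0r.
Qed.

(* Gaussian elimination: splitting off the first row and column reduces the
   inequality for [A] to the one for its Schur complement. *)
Lemma ln_det_le n (k : R) (A : 'M[R]_n) : 0 <= k <= 4^-1 -> posdef A ->
  (forall x, 4 * k * qform A x <= fro2 x) ->
  ln (\det A) <= \tr A - n%:R - k * fro2 (A - 1%:M).
Proof.
move=> kk; elim: n A => [A pA kA|n IH].
  by rewrite det_mx00 ln1 /mxtrace big_ord0 subrr /fro2 big_ord0 mulr0 subrr.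
rewrite -[n.+1]/(1 + n)%N => A pA kA; have := kA; have := pA.
rewrite (posdef_block_split pA) {pA kA}.
move: (A 0 0) (dlsubmx A) (drsubmx A) => a v D pA kA.
have [a0 pS] := posdef_block pA.
have an0 : a != 0 by rewrite gt_eqF.
set S := D - _ in pS.
have qS y : qform S y = qform D y - a^-1 * (v^T *m y) 0 0 ^+ 2.
  by rewrite qformB qformZ qform_outer.
have kD y : 4 * k * qform D y <= fro2 y.
  have := kA (col_mx 0 y); rewrite qform_block.
  by rewrite !fro2_vec tr_col_mx mul_row_col trmx0 mul0mx add0r.
have ka : 4 * k * a <= 1.
  have := kA (col_mx 1%:M 0).
  rewrite fro2_vec /qform !tr_col_mx !mul_row_block !mul_row_col trmx0 !mul0mx.
  by rewrite !mulmx0 !addr0 tr_scalar_mx !mul1mx !mulmx1 !mxE eqxx/= mulr1n.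
have kS y : 4 * k * qform S y <= fro2 y.
  apply: le_trans (kD y); rewrite qS ler_wpM2l//; first by case/andP: kk => *; lra.
  by rewrite gerBl mulr_ge0 ?sqr_ge0// invr_ge0 ltW.
have dE : \det (block_mx a%:M v^T v D) = a * \det S.
  have -> : block_mx a%:M v^T v D =
      block_mx 1%:M 0 (a^-1 *: v) 1%:M *m block_mx a%:M v^T 0 S.
    rewrite mulmx_block !mul0mx !mul1mx !addr0.
    by rewrite -!scalemxAl mul_mx_scalar scalerA mulVf// scale1r /S addrC subrK.
  by rewrite det_mulmx det_lblock det_ublock !det1 !mul1r det_scalar1.
have trE : \tr (block_mx a%:M v^T v D) = a + \tr S + a^-1 * fro2 v.
  rewrite mxtrace_block mxtrace_scalar mulr1n /S linearB linearZ/=.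
  by rewrite mxtrace_mulC -fro2_trace; ring.
have fE : fro2 (block_mx a%:M v^T v D - 1%:M) =
    (a - 1) ^+ 2 + 2 * fro2 v + fro2 (D - 1%:M).
  rewrite scalar_mx_block opp_block_mx add_block_mx !subr0.
  have -> : a%:M - 1%:M = (a - 1)%:M :> 'M[R]_1 by rewrite raddfB.
  rewrite fro2_block fro2_1 fro2_tr; ring.
have fS : fro2 (S - 1%:M) = fro2 (D - 1%:M)
    - 2 * a^-1 * (qform D v - fro2 v) + (a^-1 * fro2 v) ^+ 2.
  have -> : S - 1%:M = (D - 1%:M) - a^-1 *: (v *m v^T) by rewrite /S addrAC.
  have -> : fro2 (D - 1%:M - a^-1 *: (v *m v^T)) = fro2 (D - 1%:M)
    - 2 * a^-1 * qform (D - 1%:M) v + (a^-1 * fro2 v) ^+ 2.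
    move: (D - 1%:M) => B.
    have -> : qform B v = \sum_i \sum_j B i j * (v i 0 * v j 0).
      rewrite /qform -mulmxA mxE; apply: eq_bigr => i _; rewrite !mxE mulr_sumr.
      by apply: eq_bigr => j _; ring.
    have -> : (a^-1 * fro2 v) ^+ 2 = \sum_i \sum_j (a^-1 * (v i 0 * v j 0)) ^+ 2.
      rewrite exprMn [fro2 v ^+ 2]expr2 /fro2 big_distrlr/= mulr_sumr.
      apply: eq_bigr => i _.
      rewrite mulr_sumr; apply: eq_bigr => j _; rewrite !big_ord1; ring.
    rewrite /fro2 mulr_sumr -sumrB -big_split; apply: eq_bigr => i _ /=.
    rewrite mulr_sumr -sumrB -big_split; apply: eq_bigr => j _ /=.
    rewrite !mxE big_ord1 !mxE; ring.
  by rewrite qformB qform_scalar mul1r.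
have S0 := posdef_det_gt0 pS.
rewrite dE trE fE lnM ?posrE//.
have := IH S pS kS; have := ln_quadratic_le kk a0 ka; rewrite fS.
have N0 := fro2_ge0 v; have kDv := kD v.
case/andP: kk => k0 k4.
(* What remains after adding the scalar inequality for [a] and the induction hypothesis for [S].
   Once multiplied by [a], it holds because [ka] and [kDv] each cost half of [fro2 v]. *)
have : 2 * k * fro2 v <= a^-1 * fro2 v
    + k * (- 2 * a^-1 * (qform D v - fro2 v) + (a^-1 * fro2 v) ^+ 2).
  rewrite -(ler_pM2l a0).
  have -> : a * (a^-1 * fro2 v
    + k * (- 2 * a^-1 * (qform D v - fro2 v) + (a^-1 * fro2 v) ^+ 2)) =
    fro2 v - 2 * k * (qform D v - fro2 v) + k * a^-1 * fro2 v ^+ 2 by field.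
  have := sqr_ge0 (fro2 v) => N2.
  have : 0 <= k * a^-1 * fro2 v ^+ 2 by rewrite !mulr_ge0 ?invr_ge0// ltW.
  have : 4 * k * a * fro2 v <= fro2 v by rewrite ler_piMl.
  nra.
rewrite natrD; lra.
Qed.

Lemma posdef_congr n (U A : 'M[R]_n) : U \in unitmx -> posdef A ->
  posdef (U *m A *m U^T).
Proof.
move=> uU /posdef_cholesky[L uL ->].
rewrite mulmxA -mulmxA -trmx_mul; apply: gram_posdef.
by rewrite unitmx_mul uU.
Qed.

(** The hypothesis bounds [L^T], the conclusion bounds [L]. By Cauchy-Schwarz, [|L y|^4 = <y, L^T L
    y>^2 <= |y|^2 |L^T (L y)|^2 <= b |y|^2 |L y|^2]. *)
Lemma fro2_mul_gram_le n (L : 'M[R]_n) (b : R) :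
  (forall y, qform (L *m L^T) y <= b * fro2 y) ->
  forall y : 'cV_n, fro2 (L *m y) <= b * fro2 y.
Proof.
move=> Lb y; have [L0|Ln0] := eqVneq (L *m y) 0.
  apply: le_trans (Lb _); rewrite L0 qform_gram.
  by rewrite (eqP (_ : fro2 (0 : 'cV[R]_n) == 0)) ?fro2_eq0// fro2_ge0.
have N0 := fro2_gt0 Ln0; rewrite -(ler_pM2r N0).
have h : fro2 (L *m y) = \sum_i \sum_j y i j * (L^T *m (L *m y)) i j.
  rewrite [LHS]fro2_vec trmx_mul -mulmxA mxE; apply: eq_bigr => i _.
  by rewrite big_ord1 mxE.
rewrite -expr2 {1}h; apply: le_trans (fro2_cauchy_schwarz _ _) _.
rewrite [leRHS]mulrAC [leRHS]mulrC; apply: ler_wpM2l; first exact: fro2_ge0.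
by rewrite -qform_gram.
Qed.

Lemma fro2_congr_gram_le n (L X : 'M[R]_n) (b : R) : 0 <= b ->
  (forall y, qform (L *m L^T) y <= b * fro2 y) ->
  fro2 (L *m X *m L^T) <= b ^+ 2 * fro2 X.
Proof.
move=> b0 /fro2_mul_gram_le Lb.
have h (Y : 'M[R]_n) : fro2 (L *m Y) <= b * fro2 Y.
  rewrite fro2_col (fro2_col Y) mulr_sumr; apply: ler_sum => j _.
  by rewrite colE -mulmxA -colE.
rewrite -mulmxA; apply: le_trans (h _) _; rewrite expr2 -mulrA ler_wpM2l//.
by rewrite -fro2_tr trmx_mul trmxK -(fro2_tr X).
Qed.

(** With [B = L L^T], the congruence by [L^-1] turns [B] into the identity and [A] into [A'], to
    which [ln_det_le] applies. Going back costs [|A - B|_F <= b |A' - 1|_F], whence the factor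
    [b ^+ 2]. *)
Lemma ln_det_bregman n (k b : R) (A B : 'M[R]_n) :
  0 <= k <= 4^-1 -> 0 <= b -> posdef A -> posdef B ->
  (forall x, 4 * k * qform A x <= qform B x) ->
  (forall x, qform B x <= b * fro2 x) ->
  b ^+ 2 * (ln (\det A) - ln (\det B) - \tr (invmx B *m (A - B)))
    <= - k * fro2 (A - B).
Proof.
move=> kk b0 pA pB kAB Bb.
have [L uL BE] := posdef_cholesky pB.
have uB := posdef_unit pB.
have uL' : L^T \in unitmx by rewrite unitmx_tr.
pose A' := invmx L *m A *m (invmx L)^T.
have uiL : invmx L \in unitmx by rewrite unitmx_inv.
have pA' : posdef A' by exact: posdef_congr.
have AE : A = L *m A' *m L^T.
  rewrite /A' trmx_inv !mulmxA mulmxV// mul1mx -mulmxA mulVmx// mulmx1//.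
have ABE : A - B = L *m (A' - 1%:M) *m L^T.
  by rewrite mulmxBr mulmxBl -AE mulmx1 -BE.
have kA' x : 4 * k * qform A' x <= fro2 x.
  have := kAB (invmx L^T *m x).
  rewrite BE qform_gram mulKVmx//; congr (_ * _ <= _).
  by rewrite /qform /A' trmx_mul !trmx_inv trmxK !mulmxA.
have := ln_det_le kk pA' kA'.
have -> : ln (\det A') = ln (\det A) - ln (\det B).
  rewrite -ln_div ?posrE ?posdef_det_gt0//; congr ln.
  rewrite {1}AE BE !det_mulmx; field.
  by rewrite det_tr -unitfE -unitmxE uL.
have iBE : invmx B = (invmx L)^T *m invmx L.
  have h : B *m ((invmx L)^T *m invmx L) = 1%:M.
    by rewrite BE trmx_inv mulmxA mulmxK// mulmxV.
  by rewrite -[RHS]mul1mx -(mulVmx uB) -mulmxA h mulmx1.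
have -> : \tr (invmx B *m (A - B)) = \tr A' - n%:R.
  rewrite mulmxBr linearB/= mulVmx// mxtrace_scalar; congr (_ - _).
  by rewrite iBE -mulmxA mxtrace_mulC.
move=> h; apply: (@le_trans _ _ (b ^+ 2 * - (k * fro2 (A' - 1%:M)))).
  by rewrite ler_wpM2l ?sqr_ge0//; lra.
rewrite mulrN mulNr lerN2 mulrCA ler_wpM2l//; first by case/andP: kk.
by rewrite ABE fro2_congr_gram_le// => y; rewrite -BE.
Qed.

Lemma qform_addZ n (B : 'M[R]_n) (x y : 'cV_n) t : B^T = B ->
  qform B (x + t *: y) =
  qform B x + 2 * t * (y^T *m (B *m x)) 0 0 + t ^+ 2 * qform B y.
Proof.
move=> sB; rewrite /qform (_ : (x + t *: y)^T = x^T + t *: y^T); last first.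
  by rewrite linearD linearZ.
rewrite !(mulmxDl, mulmxDr) -!scalemxAr -!scalemxAl -?scalemxAr.
have tr1 (Z : 'M[R]_1) : Z^T = Z by apply/matrixP => i j; rewrite !ord1 mxE.
have -> : y^T *m B *m x = x^T *m B *m y.
  by rewrite -[LHS]tr1 !trmx_mul trmxK sB mulmxA.
have -> : y^T *m (B *m x) = x^T *m B *m y.
  by rewrite -[LHS]tr1 !trmx_mul trmxK sB.
move: (x^T *m B *m x) (x^T *m B *m y) (y^T *m B *m y) => p q r.
by rewrite !mxE; ring.
Qed.

Lemma psd_null n (B : 'M[R]_n) x : B^T = B -> (forall y, 0 <= qform B y) ->
  qform B x = 0 -> B *m x = 0.
Proof.
move=> sB pB Bx; apply/eqP; rewrite -fro2_eq0; apply/eqP.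
(* A step towards the minimum of the parabola along [B x]. Dividing by [1 + q] instead of [q] covers
   the case [q = 0] and still makes the form negative unless [B x = 0]. *)
have := pB (x + - (fro2 (B *m x) / (1 + qform B (B *m x))) *: (B *m x)).
rewrite qform_addZ// Bx add0r -fro2_vec.
have q0 := pB (B *m x).
move: (fro2 _) (qform _ _) q0 => s q q0.
have -> : 2 * - (s / (1 + q)) * s + (- (s / (1 + q))) ^+ 2 * q =
  - ((s / (1 + q)) ^+ 2 * (2 + q)) by field; rewrite gt_eqF//; lra.
rewrite oppr_ge0 pmulr_lle0; last lra.
rewrite real_exprn_even_le0 ?num_real//= mulf_eq0 invr_eq0.
have q1 : 1 + q != 0 by rewrite gt_eqF//; lra.
by rewrite (negbTE q1) orbF => /eqP.
Qed.

Lemma l2norm_ge0 n (x : 'cV[R]_n) : 0 <= l2norm x.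
Proof. exact: sqrtr_ge0. Qed.

Lemma l2norm_sqr n (x : 'cV[R]_n) : l2norm x ^+ 2 = fro2 x.
Proof. by rewrite l2normE sqr_sqrtr// fro2_ge0. Qed.

Lemma l2normZ n a (x : 'cV[R]_n) : l2norm (a *: x) = `|a| * l2norm x.
Proof. by rewrite !l2normE fro2Z sqrtrM ?sqr_ge0// sqrtr_sqr. Qed.

Lemma l2norm_eq1 n (x : 'cV[R]_n) : l2norm x = 1 -> fro2 x = 1.
Proof. by rewrite -l2norm_sqr => ->; rewrite expr1n. Qed.

Lemma l2norm_unit n (x : 'cV[R]_n) : x != 0 -> l2norm ((l2norm x)^-1 *: x) = 1.
Proof.
move=> x0; have l0 : 0 < l2norm x by rewrite l2normE sqrtr_gt0 fro2_gt0.
by rewrite l2normZ ger0_norm ?invr_ge0 ?ltW// mulVf// gt_eqF.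
Qed.

Lemma sym_eigenvalue_min n (A : 'M[R]_n) : (0 < n)%N -> A^T = A ->
  exists2 m, eigenvalue A m & forall x, m * fro2 x <= qform A x.
Proof.
case: n A => // n A _ sA.
pose E := [set qform A x | x in [set x : 'cV[R]_n.+1 | fro2 x = 1]].
have E0 : E !=set0.
  exists (qform A (delta_mx 0 0)), (delta_mx 0 0) => //=.
  by rewrite fro2_vec trmx_delta mul_delta_mx mxE !eqxx.
have lbE : has_lbound E.
  exists (- Num.sqrt (fro2 A)) => _ [x x1 <-].
  by have := qform_fro_le A x; rewrite ler_norml x1 mulr1 => /andP[].
pose m := inf E.
have mle x : m * fro2 x <= qform A x.
  have [->|x0] := eqVneq x 0.
    by rewrite /qform mulmx0 mxE fro2_vec mulmx0 mxE mulr0.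
  have x2 := fro2_gt0 x0.
  have : m <= qform A ((Num.sqrt (fro2 x))^-1 *: x).
    apply: ge_inf => //; eexists; last by [].
    by rewrite /= fro2Z exprVn sqr_sqrtr ?ltW// mulVf// gt_eqF.
  rewrite qformZv exprVn (sqr_sqrtr (ltW x2)) => h.
  by rewrite mulrC -ler_pdivlMl.
exists m => //.
have pB x : 0 <= qform (A - m%:M) x by rewrite qformB qform_scalar subr_ge0.
have sB : (A - m%:M)^T = A - m%:M by rewrite linearB/= tr_scalar_mx sA.
apply: contraT => em.
have uB : A - m%:M \in unitmx.
  by rewrite -row_free_unit -kermx_eq0; move: em; rewrite /eigenvalue negbK.
have [e e0 eB] : exists2 e : R, 0 < e &
    forall x, e * fro2 x <= qform (A - m%:M) x.
  apply: posdef_gap; split=> // x x0; rewrite lt_neqAle pB andbT eq_sym.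
  apply: contra_neq x0 => /(psd_null sB pB) h.
  by rewrite -(mulKmx uB x) h mulmx0.
suff : m + e <= m by rewrite gerDl leNgt e0.
apply: lb_le_inf => // _ [x x1 <-].
by have := eB x; rewrite qformB qform_scalar x1; lra.
Qed.

Lemma eigenvalue_qform n (A : 'M[R]_n) (a : R) : eigenvalue A a ->
  exists2 x : 'cV[R]_n, x != 0 & qform A x = a * fro2 x.
Proof.
move=> /eigenvalueP[v vA v0]; exists v^T.
  by apply: contra_neq v0 => /(congr1 trmx); rewrite trmxK trmx0.
by rewrite /qform trmxK vA -scalemxAl mxE fro2_vec trmxK.
Qed.

Lemma lambda_min_le_qform n (A : 'M[R]_n) x : (0 < n)%N -> A^T = A ->
  lambda_min A * fro2 x <= qform A x.
Proof.
move=> n0 /(sym_eigenvalue_min n0)[m em mA].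
apply: le_trans (mA x); rewrite ler_wpM2r ?fro2_ge0//; apply: ge_inf => //.
exists m => a /eigenvalue_qform[y y0 yE].
by rewrite -(ler_pM2r (fro2_gt0 y0)) -yE.
Qed.

Lemma qform_le_lambda_max n (A : 'M[R]_n) x : (0 < n)%N -> A^T = A ->
  qform A x <= lambda_max A * fro2 x.
Proof.
move=> n0 sA; have [|m em mA] := @sym_eigenvalue_min n (- A) n0.
  by rewrite linearN/= sA.
have := mA x; rewrite qformN lerNr -mulNr => /le_trans; apply.
rewrite ler_wpM2r ?fro2_ge0//; apply: ub_le_sup.
  exists (- m) => a /eigenvalue_qform[y y0 yE].
  by rewrite -(ler_pM2r (fro2_gt0 y0)) -yE mulNr lerNr -qformN.
move/eigenvalueP : em => [v vA v0]; apply/eigenvalueP; exists v => //.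
by rewrite scaleNr -vA mulmxN opprK.
Qed.

Lemma spectral_norm_ub n (A : 'M[R]_n) :
  has_ubound [set l2norm (A *m x) | x in [set x | l2norm x = 1]].
Proof.
exists (Num.sqrt (fro2 A)) => _ [x /l2norm_eq1 x1 <-].
by rewrite l2normE ler_wsqrtr// (le_trans (fro2_mulmx _ _))// x1 mulr1.
Qed.

Lemma l2norm_mulmx_le n (A : 'M[R]_n) x :
  l2norm (A *m x) <= spectral_norm A * l2norm x.
Proof.
have [->|x0] := eqVneq x 0.
  by rewrite mulmx0 l2normE (eqP (_ : fro2 _ == 0)) ?fro2_eq0// sqrtr0 mulr0.
have l0 : 0 < l2norm x by rewrite l2normE sqrtr_gt0 fro2_gt0.
rewrite -ler_pdivrMr//; apply: ub_le_sup; first exact: spectral_norm_ub.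
exists ((l2norm x)^-1 *: x); first exact: l2norm_unit.
by rewrite -scalemxAr l2normZ ger0_norm ?invr_ge0 ?ltW// mulrC.
Qed.

Lemma spectral_norm_ge0 n (A : 'M[R]_n) : 0 <= spectral_norm A.
Proof.
rewrite /spectral_norm.
have [->|/set0P[y [x x1 _]]] :=
  eqVneq [set l2norm (A *m x) | x in [set x | l2norm x = 1]] set0.
  by rewrite sup0.
apply: (le_trans (l2norm_ge0 (A *m x))).
by apply: ub_le_sup; [exact: spectral_norm_ub|exists x].
Qed.

Lemma spectral_norm_le n (A : 'M[R]_n) K : 0 <= K ->
  (forall x, l2norm (A *m x) <= K * l2norm x) -> spectral_norm A <= K.
Proof.
move=> K0 AK; rewrite /spectral_norm.
have [->|E0] := eqVneq [set l2norm (A *m x) | x in [set x | l2norm x = 1]] set0.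
  by rewrite sup0.
apply: sup_le_ub; first exact/set0P.
by move=> _ [x x1 <-]; rewrite (le_trans (AK _))// x1 mulr1.
Qed.

Lemma spectral_norm_le_fro n (A : 'M[R]_n) :
  spectral_norm A <= Num.sqrt (fro2 A).
Proof.
apply: spectral_norm_le; first exact: sqrtr_ge0.
by move=> x; rewrite !l2normE -sqrtrM ?fro2_ge0// ler_wsqrtr// fro2_mulmx.
Qed.

Lemma spectral_normD n (A B : 'M[R]_n) :
  spectral_norm (A + B) <= spectral_norm A + spectral_norm B.
Proof.
apply: spectral_norm_le => [|x]; first by rewrite addr_ge0 ?spectral_norm_ge0.
rewrite mulmxDl mulrDl (le_trans _ (lerD (l2norm_mulmx_le A x) (l2norm_mulmx_le B x)))//.
by rewrite !l2normE fro_triangle.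
Qed.

Lemma spectral_normM n (A B : 'M[R]_n) :
  spectral_norm (A *m B) <= spectral_norm A * spectral_norm B.
Proof.
apply: spectral_norm_le => [|x]; first by rewrite mulr_ge0 ?spectral_norm_ge0.
rewrite -mulmxA -mulrA (le_trans (l2norm_mulmx_le A _))//.
by rewrite ler_wpM2l ?spectral_norm_ge0// l2norm_mulmx_le.
Qed.

Lemma spectral_norm_diag n (v : 'rV[R]_n) K : 0 <= K ->
  (forall i, `|v 0 i| <= K) -> spectral_norm (diag_mx v) <= K.
Proof.
move=> K0 vK; apply: spectral_norm_le => // x.
rewrite !l2normE -[K in leRHS]ger0_norm// -sqrtr_sqr -sqrtrM ?sqr_ge0//.
rewrite ler_wsqrtr// /fro2 mulr_sumr; apply: ler_sum => i _.
rewrite !big_ord1 mul_diag_mx mxE exprMn ler_wpM2r ?sqr_ge0//.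
by rewrite -real_normK ?num_real// ler_sqr ?nnegrE.
Qed.

Lemma qform_le_spectral n (A : 'M[R]_n) x :
  qform A x <= spectral_norm A * fro2 x.
Proof.
have -> : qform A x = \sum_i \sum_j x i j * (A *m x) i j.
  rewrite /qform -mulmxA mxE.
  by apply: eq_bigr => i _; rewrite big_ord1 mxE.
apply: le_trans (sum_mul_le_fro _ _) _; rewrite -!l2normE.
rewrite -l2norm_sqr expr2 mulrA mulrC ler_wpM2r ?l2norm_ge0//.
exact: l2norm_mulmx_le.
Qed.

Lemma posdef_spectral_le n (A : 'M[R]_n) b : 0 <= b -> posdef A ->
  (forall x, qform A x <= b * fro2 x) -> spectral_norm A <= b.
Proof.
move=> b0 pA Ab; apply: spectral_norm_le => // x.
have [L uL AE] := posdef_cholesky pA.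
rewrite !l2normE -[b in leRHS]ger0_norm// -sqrtr_sqr -sqrtrM ?sqr_ge0//.
rewrite ler_wsqrtr// AE -mulmxA (le_trans (fro2_mul_gram_le (b := b) _ _))//.
  by rewrite -AE.
by rewrite expr2 -mulrA ler_wpM2l// -qform_gram -AE.
Qed.

End positive_definite.

(** * Products of independent variables and Gaussian squares *)

Section simple_approximation.
Import HBNNSimple.
Context {R : realType} {disp disp' : measure_display} {T : measurableType disp}
  {T' : measurableType disp'}.
Implicit Types (mu : {measure set T -> \bar R}).
Local Open Scope ereal_scope.

Lemma integral_nnsfun_comp_mul mu (xi : T -> T') (H : T -> R)
    (h : {nnsfun T' >-> R}) :
  measurable_fun [set: T] xi -> measurable_fun [set: T] H ->
  (forall x, 0 <= H x)%R ->
  \int[mu]_x (h (xi x) * H x)%:E =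
  \sum_(r <- finmap.enum_fset (fset_set (range h)))
    r%:E * \int[mu]_x (\1_(h @^-1` [set r]) (xi x) * H x)%:E.
Proof.
move=> mxi mH H0.
have mI r : measurable_fun [set: T]
    (fun x => (\1_(h @^-1` [set r]) (xi x) * H x)%:E).
  apply/measurable_EFinP; apply: measurable_funM => //.
  rewrite -[X in measurable_fun _ X]/(\1_(h @^-1` [set r]) \o xi).
  by apply: (measurableT_comp _ mxi).
transitivity (\int[mu]_x \sum_(r \in range h)
    (r%:E * (\1_(h @^-1` [set r]) (xi x) * H x)%:E)).
  apply: eq_integral => x _; rewrite {1}(fimfunE h).
  rewrite fsbig_finite//= [in RHS]fsbig_finite//= mulr_suml -sumEFin.
  by apply: eq_bigr => r _; rewrite -EFinM mulrA.
rewrite ge0_integral_fsum//.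
- rewrite fsbig_finite//=.
  rewrite big_seq [in RHS]big_seq; apply: eq_bigr => r.
  rewrite in_fset_set// inE => -[y _ <-]; rewrite ge0_integralZl//.
  + by move=> x _; rewrite lee_fin mulr_ge0.
  + by rewrite lee_fin.
- by move=> r; apply: emeasurable_funM.
- move=> r x _; rewrite -EFinM mulrA EFinM mule_ge0 ?lee_fin//.
  exact: nnfun_muleindic_ge0.
Qed.

Lemma cvg_integral_nnsfun_approx mu (xi : T -> T') (H : T -> R) (f : T' -> R)
    (mf : measurable_fun [set: T'] (EFin \o f)) :
  measurable_fun [set: T] xi -> measurable_fun [set: T] H ->
  (forall x, 0 <= H x)%R -> (forall y, 0 <= f y)%R ->
  \int[mu]_x (nnsfun_approx measurableT mf n (xi x) * H x)%:E @[n --> \oo] -->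
  \int[mu]_x (f (xi x) * H x)%:E.
Proof.
move=> mxi mH H0 f0; set h := nnsfun_approx measurableT mf.
have hcvg y : (h n y)%:E @[n --> \oo] --> (f y)%:E.
  by apply: (cvg_nnsfun_approx measurableT mf) => // t _; rewrite lee_fin.
have -> : \int[mu]_x (f (xi x) * H x)%:E =
    \int[mu]_x limn (fun n => (h n (xi x) * H x)%:E).
  apply: eq_integral => x _; apply/esym/cvg_lim => //.
  under eq_fun do rewrite EFinM.
  by rewrite EFinM; apply: cvgeZr.
apply: cvg_monotone_convergence => //.
- move=> n; apply/measurable_EFinP; apply: measurable_funM => //.
  exact: measurableT_comp.
- by move=> n x _; rewrite lee_fin mulr_ge0.
- move=> x _ a b ab; rewrite lee_fin ler_wpM2r//.
  exact/lefP/(nd_nnsfun_approx _ _ ab).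
Qed.

End simple_approximation.

Section change_of_measure.
Import HBNNSimple.
Context {R : realType} {disp disp' : measure_display} {T : measurableType disp}
  {T' : measurableType disp'}.
Context (mu : {measure set T -> \bar R}) (nu : {measure set T' -> \bar R}).
Local Open Scope ereal_scope.

(** An identity known for indicators extends to nonnegative functions by simple approximation and
    monotone convergence. Three uses: splitting off one independent factor ([nu] the law of [xi]),
    integrating against a normal density ([xi] the identity), and transferring to the law of a
    linear form ([H = 1]). *)
Lemma integral_density_comp (xi : T -> T') (H : T -> R) (c : R) (f : T' -> R) :
  measurable_fun [set: T] xi -> measurable_fun [set: T] H ->
  (forall x, 0 <= H x)%R ->
  (forall B, measurable B ->
    \int[mu]_x (\1_B (xi x) * H x)%:E = nu B * c%:E) ->
  measurable_fun [set: T'] f -> (forall y, 0 <= f y)%R ->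
  \int[mu]_x (f (xi x) * H x)%:E = \int[nu]_y (f y)%:E * c%:E.
Proof.
move=> mxi mH H0 Hc mf f0.
have mEf : measurable_fun [set: T'] (EFin \o f) by exact/measurable_EFinP.
pose h := nnsfun_approx measurableT mEf.
have h1 n : \int[mu]_x (h n (xi x) * H x)%:E =
    \int[nu]_y (h n y * cst 1 y)%:E * c%:E.
  rewrite integral_nnsfun_comp_mul// (@integral_nnsfun_comp_mul _ _ _ _ _ nu id)//.
  have rge0 r : r \in finmap.enum_fset (fset_set (range (h n))) -> (0 <= r)%R.
    by rewrite in_fset_set// inE => -[y _ <-].
  rewrite big_seq [in RHS]big_seq ge0_sume_distrl; last first.
    move=> r /rge0 r0; rewrite mule_ge0 ?lee_fin//; apply: integral_ge0 => x _.
    by rewrite lee_fin mulr_ge0.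
  apply: eq_bigr => r _; rewrite Hc// -muleA; congr (_ * (_ * _)).
  under eq_integral do rewrite /cst mulr1.
  by rewrite integral_indic ?setIT.
have := cvg_integral_nnsfun_approx mEf mxi mH H0 f0 (mu := mu).
under eq_fun do rewrite h1.
move=> /cvg_unique; apply => //.
have -> : \int[nu]_y (f y)%:E = \int[nu]_y (f y * cst 1 y)%:E.
  by apply: eq_integral => y _; rewrite mulr1.
by apply: cvgeZr => //; apply: (@cvg_integral_nnsfun_approx _ _ _ _ _ nu id).
Qed.

End change_of_measure.

Section independent_products.
Context {R : realType} {disp : measure_display} {T : measurableType disp}.
Context (P : probability T R) {disp' : measure_display}
  {T' : measurableType disp'}.
Local Open Scope ereal_scope.

Lemma integral_factor (xi : T -> T') (H : T -> R) (c : R) (f : T' -> R) :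
  measurable_fun [set: T] xi -> measurable_fun [set: T] H ->
  (forall x, 0 <= H x)%R ->
  (forall B, measurable B ->
    \int[P]_x (\1_B (xi x) * H x)%:E = P (xi @^-1` B) * c%:E) ->
  measurable_fun [set: T'] f -> (forall y, 0 <= f y)%R ->
  \int[P]_x (f (xi x) * H x)%:E = \int[P]_x (f (xi x))%:E * c%:E.
Proof.
move=> mxi mH H0 Hc mf f0.
rewrite (integral_density_comp (nu := pushforward P xi) mxi mH H0 Hc mf f0).
rewrite ge0_integral_pushforward//; first exact/measurable_EFinP.
by move=> y _; rewrite lee_fin.
Qed.

Lemma measurable_fun_prod_comp (I : finType) (Q : pred I) (xi : I -> T -> T')
    (f : I -> T' -> R) :
  (forall i, measurable_fun [set: T] (xi i)) ->
  (forall i, measurable_fun [set: T'] (f i)) ->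
  measurable_fun [set: T] (fun x => \prod_(i | Q i) f i (xi i x))%R.
Proof.
move=> mxi mf; under eq_fun do rewrite -big_filter.
apply: measurable_prod => i _.
exact: (measurableT_comp (mf i) (mxi i)).
Qed.

(* Replacing indicators by arbitrary nonnegative functions, one at a time. *)
Lemma integral_prod_independent n (xi : 'I_n -> T -> T') (f : 'I_n -> T' -> R)
    (c : 'I_n -> R) :
  (forall i, measurable_fun [set: T] (xi i)) ->
  (forall B : 'I_n -> set T', (forall i, measurable (B i)) ->
    P (\bigcap_(i in [set: 'I_n]) (xi i @^-1` B i)) =
    \prod_(i < n) P (xi i @^-1` B i)) ->
  (forall i, measurable_fun [set: T'] (f i)) -> (forall i y, 0 <= f i y)%R ->
  (forall i, \int[P]_x (f i (xi i x))%:E = (c i)%:E) ->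
  \int[P]_x (\prod_(i < n) f i (xi i x))%:E = (\prod_(i < n) c i)%:E.
Proof.
move=> mxi ind.
(* Induction on [k], where the factors of index at least [k] are indicators: [k = 0] is the
   independence of events, [k = n] the claim. *)
suff : forall k, forall (f : 'I_n -> T' -> R) (c : 'I_n -> R),
    (forall i : 'I_n, (k <= i)%N ->
      exists B : set T', measurable B /\ f i = \1_B) ->
    (forall i, measurable_fun [set: T'] (f i)) -> (forall i y, 0 <= f i y)%R ->
    (forall i, \int[P]_x (f i (xi i x))%:E = (c i)%:E) ->
    \int[P]_x (\prod_(i < n) f i (xi i x))%:E = (\prod_(i < n) c i)%:E.
  by move=> /(_ n f c); apply => i; rewrite leqNgt ltn_ord.
have mpre i B : measurable B -> measurable (xi i @^-1` B).
  by move=> mB; rewrite -[X in measurable X]setTI; exact: mxi.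
elim=> [|k IH] {}f {}c fB mf f0 fc.
  have /choice[B fBE] := fun i => fB i (leq0n i).
  have cE i : (c i)%:E = P (xi i @^-1` B i).
    have [mB fE] := fBE i.
    rewrite -fc fE (eq_integral (fun x => (\1_(xi i @^-1` B i) x)%:E))//.
    by rewrite integral_indic ?setIT//; exact: mpre.
  have -> : (\prod_(i < n) c i)%:E = \prod_(i < n) P (xi i @^-1` B i).
    rewrite -prodEFin.
    by apply: eq_bigr => i _.
  rewrite -ind; last by move=> i; case: (fBE i).
  rewrite -[X in _ = P X](setIT (\bigcap_(i in _) _)) -integral_indic//; last first.
    by apply: fin_bigcap_measurable => // i _; apply: mpre; case: (fBE i).
  apply: eq_integral => x _; congr EFin.
  rewrite indicE; have [xB|/existsNP[i xB]] := pselect (forall i, B i (xi i x)).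
    have -> : x \in \bigcap_(i in [set: 'I_n]) xi i @^-1` B i.
      by rewrite inE => i _; exact: xB.
    apply: big1 => i _.
    by have [_ ->] := fBE i; rewrite indicE mem_set.
  have -> : (x \in \bigcap_(i in [set: 'I_n]) xi i @^-1` B i) = false.
    by apply/negbTE; rewrite notin_setE => /(_ i I).
  rewrite (bigD1 i)//=; have [_ ->] := fBE i.
  by rewrite indicE memNset ?mul0r.
have [nk|kn] := leqP n k.
  apply: IH => // i ki; apply: fB; apply: contraT => _.
  by have := ltn_ord i; rewrite ltnNge (leq_trans nk ki).
pose i0 := Ordinal kn.
rewrite (bigD1 i0)//=.
transitivity (\int[P]_x (f i0 (xi i0 x) * \prod_(i < n | i != i0) f i (xi i x))%:E).
  by apply: eq_integral => x _; rewrite (bigD1 i0).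
rewrite (integral_factor (c := \prod_(i < n | i != i0) c i)%R) ?EFinM ?fc//.
- exact: measurable_fun_prod_comp.
- by move=> x; apply: prodr_ge0.
- move=> B mB.
  (* Putting the indicator of [B] in place of the factor [i0] leaves indicators from index [k] on,
     so the induction hypothesis supplies what [integral_factor] asks for. *)
  pose f' i := if i == i0 then \1_B else f i.
  pose c' i := if i == i0 then fine (P (xi i0 @^-1` B)) else c i.
  have /= := IH f' c' _ _ _ _.
  rewrite (bigD1 i0)//= /c' eqxx EFinM fineK ?fin_num_measure//; last exact: mpre.
  rewrite (eq_bigr c); last by move=> i /negbTE ->.
  move=> <-.
  + apply: eq_integral => x _; rewrite [in RHS](bigD1 i0)//= /f' eqxx.
    by congr (_ * _)%:E; apply: eq_bigr => i /negbTE ->.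
  + move=> i ki; rewrite /f'; case: eqP => [_|ii0]; first by exists B.
    apply: fB; rewrite ltn_neqAle ki andbT; apply/eqP => ki'; apply: ii0.
    exact: val_inj.
  + by move=> i; rewrite /f'; case: ifP => // _; exact: measurable_indic.
  + by move=> i y; rewrite /f'; case: ifP.
  + move=> i; rewrite /f'; case: eqP => [->|//].
    rewrite (eq_integral (fun x => (\1_(xi i0 @^-1` B) x)%:E))//.
    rewrite integral_indic ?setIT ?fineK ?fin_num_measure//; exact: mpre.
Qed.

End independent_products.

Section gaussian_square.
Context {R : realType}.

Lemma integral_normal_prob (m s : R) (f : R -> R) :
  measurable_fun [set: measurableTypeR R] f -> (forall y, 0 <= f y) ->
  (\int[normal_prob m s]_y (f y)%:E =
   \int[lebesgue_measure]_y (f y * normal_pdf m s y)%:E)%E.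
Proof.
move=> mf f0; rewrite -[LHS]mule1; apply/esym.
apply: (@integral_density_comp _ _ _ _ _ lebesgue_measure (normal_prob m s) id) => //.
- exact: measurable_normal_pdf.
- exact: normal_pdf_ge0.
- move=> B mB; rewrite mule1 /= /normal_prob [RHS]integral_mkcond.
  apply: eq_integral => x _; rewrite patchE indicE.
  by case: ifP => _; rewrite ?mul1r ?mul0r.
Qed.

(** For [y = 2 t] the left side is the moment generating function of a centred chi-square. From
    [(1 - y)^-1 <= exp (y / (1 - y))] the exponent is at most [y^2 / (2 (1 - y))], and
    [1 - y >= 1/2]. *)
Lemma inv_sqrt_expR_le (y : R) : y <= 2^-1 -> - 2^-1 <= y ->
  (Num.sqrt (1 - y))^-1 * expR (- (y / 2)) <= expR (y ^+ 2).
Proof.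
move=> y2 y2'; have y1 : 0 < 1 - y by lra.
have h : (1 - y)^-1 <= expR (y / (1 - y)).
  apply: le_trans (expR_ge1Dx _); rewrite [leRHS](_ : _ = (1 - y)^-1)//.
  by field; rewrite gt_eqF.
have h2 : (Num.sqrt (1 - y))^-1 <= expR (y / (1 - y) / 2).
  rewrite -ler_sqr ?nnegrE ?expR_ge0 ?invr_ge0 ?sqrtr_ge0//.
  have -> : (Num.sqrt (1 - y))^-1 ^+ 2 = (1 - y)^-1.
    by rewrite exprVn sqr_sqrtr// ltW.
  by rewrite expr2 -expRD -splitr.
apply: le_trans (ler_wpM2r (expR_ge0 _) h2) _.
rewrite -expRD ler_expR.
have -> : y / (1 - y) / 2 + - (y / 2) = y ^+ 2 * ((1 - y)^-1 / 2).
  by field; rewrite gt_eqF.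
rewrite ler_piMr ?sqr_ge0//; rewrite -ler_pdivlMr// mul1r invrK.
by rewrite -[leRHS]invrK lef_pV2 ?posrE ?invr_gt0//; lra.
Qed.

Lemma normal_pdfM (m s x : R) : s != 0 ->
  normal_pdf m s x = normal_peak s * normal_fun m s x.
Proof. by move=> s0; rewrite /normal_pdf (negbTE s0). Qed.

(** The exponential tilt of the density is again a multiple of a centred normal density, of variance
    [v / (1 - 2 t)], and that density integrates to 1. *)
Lemma normal_prob_expR_sqr (v t : R) : 0 < v -> t < 2^-1 ->
  (\int[normal_prob 0 (Num.sqrt v)]_y (expR (t * (y ^+ 2 / v - 1)))%:E =
   ((Num.sqrt (1 - 2 * t))^-1 * expR (- t))%:E)%E.
Proof.
move=> v0 t2; have t1 : 0 < 1 - 2 * t by lra.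
have sv : Num.sqrt v != 0 by rewrite gt_eqF// sqrtr_gt0.
have exponentE (y : R) : t * (y ^+ 2 / v - 1) + - y ^+ 2 / (v *+ 2) =
    - t + - y ^+ 2 / (v / (1 - 2 * t) *+ 2).
  rewrite (mulr2n v) (mulr2n (v / _)); field.
  by rewrite !gt_eqF// ?addr_gt0 ?divr_gt0.
rewrite integral_normal_prob//; last first.
  apply: measurableT_comp => //; apply: measurable_funM => //.
  apply: measurable_funB => //; apply: measurable_funM => //.
pose s' := Num.sqrt (v / (1 - 2 * t)).
have s'0 : s' != 0 by rewrite gt_eqF// sqrtr_gt0 divr_gt0.
transitivity (\int[lebesgue_measure]_y
  (((Num.sqrt (1 - 2 * t))^-1 * expR (- t))%:E * (normal_pdf 0 s' y)%:E))%E.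
  apply: eq_integral => y _; rewrite -EFinM; congr EFin.
  rewrite !normal_pdfM// /normal_peak /normal_fun !subr0.
  rewrite !sqr_sqrtr ?(ltW v0) ?divr_ge0 ?(ltW v0) ?(ltW t1)//.
  have -> : v * pi *+ 2 = (1 - 2 * t) * (v / (1 - 2 * t) * pi *+ 2).
    rewrite (mulr2n (v * pi)) (mulr2n (v / _ * pi)); move: (pi : R) => p.
    by field; rewrite gt_eqF.
  rewrite [Num.sqrt ((1 - 2 * t) * _)]sqrtrM ?(ltW t1)// invfM.
  rewrite mulrCA -expRD [RHS]mulrACA -mulrA -expRD mulrA; congr (_ * expR _).
  exact: exponentE.
rewrite ge0_integralZl//= ?integral_normal_pdf ?mule1//.
- by apply/measurable_EFinP; exact: measurable_normal_pdf.
- by move=> x _; rewrite lee_fin normal_pdf_ge0.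
Qed.

End gaussian_square.

(** * Gaussian quadratic forms *)

Section gaussian_sample.
Context {R : realType} {disp : measure_display} {Omega : measurableType disp}.
Context (P : probability Omega R).

Lemma prob_le_integral (A : set Omega) (f : Omega -> R) : measurable A ->
  measurable_fun [set: Omega] f -> (forall x, 0 <= f x) ->
  (forall x, A x -> 1 <= f x) -> (P A <= \int[P]_x (f x)%:E)%E.
Proof.
move=> mA mf f0 Af; rewrite -[X in P X]setIT -integral_indic//.
apply: ge0_le_integral => //.
- exact/measurable_EFinP/measurable_indic.
- exact/measurable_EFinP.
- move=> x _; rewrite lee_fin indicE; have [/set_mem/Af//|_] := boolP (x \in A).
  exact: f0.
Qed.

Lemma integral_scale_add_le (c A B : R) (f g : Omega -> R) : 0 <= c ->
  measurable_fun [set: Omega] f -> measurable_fun [set: Omega] g ->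
  (forall x, 0 <= f x) -> (forall x, 0 <= g x) ->
  (\int[P]_x (f x)%:E <= A%:E)%E -> (\int[P]_x (g x)%:E <= B%:E)%E ->
  (\int[P]_x (c * (f x + g x))%:E <= (c * (A + B))%:E)%E.
Proof.
move=> c0 mf mg f0 g0 fA gB.
under eq_integral do rewrite EFinM.
rewrite ge0_integralZl//.
- rewrite EFinM lee_wpmul2l ?lee_fin//.
  under eq_integral do rewrite EFinD.
  rewrite ge0_integralD// ?EFinD ?leeD//; try exact/measurable_EFinP.
  + by move=> x _; rewrite lee_fin.
  + by move=> x _; rewrite lee_fin.
- by apply/measurable_EFinP; exact: measurable_funD.
- by move=> x _; rewrite lee_fin addr_ge0.
Qed.

Definition linform {d} (a : 'cV[R]_d) (Y : 'I_d -> Omega -> R) omega : R :=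
  \sum_j a j 0 * Y j omega.

Lemma measurable_linform d (a : 'cV[R]_d) (Y : 'I_d -> {RV P >-> R}) :
  measurable_fun [set: Omega] (linform a (fun j => Y j)).
Proof. by apply: measurable_sum => j; apply: measurable_funM. Qed.

(** Independence is assumed for the sigma-algebras generated by the coordinates. A linear form is
    measurable for that sigma-algebra because the coordinates are, once [Omega] is equipped with it
    alone. *)
Lemma g_sigma_linform d (a : 'cV[R]_d) (Y : 'I_d -> {RV P >-> R})
    (B : set R) : measurable B ->
  g_sigma_preimage (fun j => Y j : Omega -> R)
    (linform a (fun j => Y j) @^-1` B).
Proof.
move=> mB.
pose G := \big[setU/set0]_(j < d) preimage_set_system [set: Omega] (Y j) measurable.
pose Omega' := g_sigma_algebraType G.
have mY (j : 'I_d) : measurable_fun [set: Omega'] (Y j : Omega' -> R).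
  move=> _ C mC; rewrite setTI.
  apply: sub_gen_smallest; rewrite /G (bigD1 j)//=; left.
  by exists C => //; rewrite setTI.
have : measurable_fun [set: Omega'] (linform a (fun j => Y j) : Omega' -> R).
  by apply: measurable_sum => j; apply: measurable_funM.
by move=> /(_ measurableT B mB); rewrite setTI.
Qed.

Context {n d : nat} (X : 'I_n -> 'I_d -> {RV P >-> R}).
Context (Sigma : 'M[R]_d).
Hypotheses (pS : posdef Sigma) (iidX : iid_gaussian X Sigma).

(** Under [iidX], for nonzero [a], an average of [n] independent centred chi-square variables with
    one degree of freedom; dividing by [qform Sigma a] makes its law independent of [Sigma] and
    [a]. *)
Definition quad_dev (a : 'cV[R]_d) (omega : Omega) : R :=
  n%:R^-1 * \sum_i linform a (fun j => X i j) omega ^+ 2 / qform Sigma a - 1.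

Lemma measurable_quad_dev a : measurable_fun [set: Omega] (quad_dev a).
Proof.
apply: measurable_funB => //; apply: measurable_funM => //.
apply: measurable_sum => i; apply: measurable_funM => //.
by apply: measurable_funX; exact: measurable_linform.
Qed.

Lemma linform_independent (a : 'cV[R]_d) (B : 'I_n -> set R) :
  (forall i, measurable (B i)) ->
  P (\bigcap_(i in [set: 'I_n]) (linform a (fun j => X i j) @^-1` B i)) =
  (\prod_(i < n) P (linform a (fun j => X i j) @^-1` B i))%E.
Proof.
move=> mB; have [_ indX] := iidX.
have := indX [set: 'I_n]%SET (fun i => linform a (fun j => X i j) @^-1` B i).
have -> : [set` [set: 'I_n]%SET] = [set: 'I_n].
  by apply/seteqP; split => // i _ /=; rewrite inE.
move=> ->; first by apply: eq_bigl => i; rewrite inE.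
by move=> i _; exact: g_sigma_linform.
Qed.

Lemma integral_expR_linform (a : 'cV[R]_d) (t : R) i : a != 0 -> t < 2^-1 ->
  (\int[P]_w (expR (t * (linform a (fun j => X i j) w ^+ 2 / qform Sigma a - 1)))%:E
   = ((Num.sqrt (1 - 2 * t))^-1 * expR (- t))%:E)%E.
Proof.
move=> a0 t2; have v0 : 0 < qform Sigma a := posdef_qform pS a0.
rewrite -(normal_prob_expR_sqr v0 t2) -[RHS]mule1.
(* The weight 1 turns the law of the linear form, given on Borel sets only, into a formula for
   expectations. *)
rewrite -(@integral_density_comp _ _ _ _ _ P (normal_prob 0 (Num.sqrt (qform Sigma a)))
  (linform a (fun j => X i j)) (cst 1) 1
  (fun y => expR (t * (y ^+ 2 / qform Sigma a - 1)))) //.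
- by apply: eq_integral => w _; rewrite mulr1.
- exact: measurable_linform.
- move=> B mB; rewrite mule1; have [gX _] := iidX.
  transitivity (P (linform a (fun j => X i j) @^-1` B)); last exact: gX.
  rewrite -[X in P X]setIT -integral_indic//.
    by apply: eq_integral => w _; rewrite mulr1.
  by rewrite -[X in measurable X]setTI; exact: measurable_linform.
- apply: measurableT_comp => //; apply: measurable_funM => //.
  by apply: measurable_funB => //; apply: measurable_funM => //.
Qed.

Lemma quad_dev_mgf (a : 'cV[R]_d) (t : R) : a != 0 -> (0 < n)%N ->
  `|t| <= 4^-1 ->
  (\int[P]_w (expR (t * n%:R * quad_dev a w))%:E
    <= (expR (4 * n%:R * t ^+ 2))%:E)%E.
Proof.
move=> a0 n0; rewrite ler_norml => /andP[t1 t2].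
have nE : n%:R != 0 :> R by rewrite pnatr_eq0 -lt0n.
have t2' : t < 2^-1 by lra.
rewrite (eq_integral (fun w => (\prod_(i < n)
  expR (t * (linform a (fun j => X i j) w ^+ 2 / qform Sigma a - 1)))%:E)); last first.
  move=> w _; rewrite -expR_sum; congr (expR _)%:E.
  rewrite -mulr_sumr sumrB sumr_const card_ord /quad_dev -mulr_suml.
  by field; rewrite nE gt_eqF// (posdef_qform pS).
rewrite (@integral_prod_independent _ _ _ P _ _ n (fun i => linform a (fun j => X i j))
  (fun=> fun y => expR (t * (y ^+ 2 / qform Sigma a - 1)))
  (fun=> (Num.sqrt (1 - 2 * t))^-1 * expR (- t))).
- rewrite prodr_const card_ord lee_fin.
  have -> : 4 * n%:R * t ^+ 2 = n%:R * (2 * t) ^+ 2 by ring.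
  rewrite expRM_natl lerXn2r ?nnegrE ?expR_ge0 ?mulr_ge0 ?expR_ge0 ?invr_ge0//.
  have {2}-> : t = 2 * t / 2 by field.
  by apply: inv_sqrt_expR_le; lra.
- by move=> i; exact: measurable_linform.
- exact: linform_independent.
- move=> i; apply: measurableT_comp => //; apply: measurable_funM => //.
  by apply: measurable_funB => //; apply: measurable_funM => //.
- by move=> i y; exact: expR_ge0.
- by move=> i; exact: integral_expR_linform.
Qed.

(** A symmetrized exponential moment: it dominates both the indicator of a two-sided tail and the
    square of [quad_dev]. *)
Lemma quad_dev_exp_le (a : 'cV[R]_d) (c t : R) : a != 0 -> (0 < n)%N ->
  0 <= c -> `|t| <= 4^-1 ->
  (\int[P]_w (c * (expR (t * n%:R * quad_dev a w)
     + expR (- t * n%:R * quad_dev a w)))%:E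
   <= (c * (expR (4 * n%:R * t ^+ 2) *+ 2))%:E)%E.
Proof.
move=> a0 n0 c0 t4.
have mE (b : R) : measurable_fun [set: Omega] (fun w => expR (b * quad_dev a w)).
  apply: measurableT_comp => //; apply: measurable_funM => //.
  exact: measurable_quad_dev.
rewrite mulr2n; apply: integral_scale_add_le => //.
- exact: quad_dev_mgf.
- by rewrite -(sqrrN t); apply: quad_dev_mgf => //; rewrite normrN.
Qed.

Lemma measurable_quad_dev_tail a (u : R) :
  measurable [set w | (u <= `|quad_dev a w|)%R].
Proof.
have -> : [set w | (u <= `|quad_dev a w|)%R] =
    (fun w => `|quad_dev a w|) @^-1` `[u, +oo[.
  by apply/seteqP; split => w /=; rewrite in_itv/= andbT.
rewrite -[X in measurable X]setTI.
apply: (measurableT_comp _ (measurable_quad_dev a)) => //.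
Qed.

Lemma quad_dev_tail (a : 'cV[R]_d) (u : R) : a != 0 -> (0 < n)%N ->
  0 < u <= 2 ->
  (P [set w | (u <= `|quad_dev a w|)%R]
    <= (2 * expR (- (n%:R * u ^+ 2 / 16)))%:E)%E.
Proof.
move=> a0 n0 /andP[u0 u2].
have mq := measurable_quad_dev a.
have mE (b : R) : measurable_fun [set: Omega] (fun w => expR (b * quad_dev a w)).
  by apply: measurableT_comp => //; apply: measurable_funM.
have r0 : 0 <= u / 8 * n%:R by rewrite mulr_ge0// divr_ge0// ltW.
(* Chernoff bound with [t = u / 8], which minimizes [4 n t^2 - n t u] and gives [- n u^2 / 16]; the
   condition [|t| <= 1/4] is [u <= 2]. *)
apply: (@le_trans _ _ (\int[P]_w (expR (- (u / 8 * n%:R * u)) *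
    (expR (u / 8 * n%:R * quad_dev a w)
     + expR (- (u / 8) * n%:R * quad_dev a w)))%:E))%E.
  apply: prob_le_integral => //.
  - exact: measurable_quad_dev_tail.
  - by apply: measurable_funM => //; apply: measurable_funD.
  - move=> w /= uw; rewrite mulrDr -!expRD.
    have [q0|q0] := leP 0 (quad_dev a w).
      rewrite ger0_norm// in uw.
      rewrite -[leLHS]addr0 lerD ?expR_ge0// -[leLHS]expR0 ler_expR.
      by rewrite addrC subr_ge0 ler_wpM2l.
    rewrite ltr0_norm// in uw.
    rewrite -[leLHS]add0r lerD ?expR_ge0// -[leLHS]expR0 ler_expR.
    by rewrite addrC mulNr mulNr -mulrN subr_ge0 ler_wpM2l.
apply: le_trans (quad_dev_exp_le _ _ _ _) _ => //.
  by rewrite ger0_norm; lra.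
have eE (x y : R) : expR x * (expR y *+ 2) = 2 * expR (x + y).
  by rewrite expRD mulr2n; ring.
rewrite lee_fin eE ler_pM2l// ler_expR.
by rewrite le_eqVlt; apply/orP; left; apply/eqP; field.
Qed.

Lemma quad_dev_second_moment (a : 'cV[R]_d) : a != 0 -> (16 <= n)%N ->
  (\int[P]_w (quad_dev a w ^+ 2)%:E <= (4 * expR 4 / n%:R)%:E)%E.
Proof.
move=> a0 n16; have n0 : (0 < n)%N by rewrite (leq_trans _ n16).
have nR : 0 < n%:R :> R by rewrite ltr0n.
have mq := measurable_quad_dev a.
have mE (b : R) : measurable_fun [set: Omega] (fun w => expR (b * quad_dev a w)).
  by apply: measurableT_comp => //; apply: measurable_funM.
(* At this scale [4 n t^2 = 4], so the exponential moments are bounded and [x^2 <= 2 (e^x + e^-x)]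
   at [x = sqrt n * quad_dev] yields the order [1 / n]. The bound [16 <= n] is [t <= 1/4]. *)
pose t : R := (Num.sqrt n%:R)^-1.
have tn : t * n%:R = Num.sqrt n%:R.
  by rewrite -{1}(sqr_sqrtr (ltW nR)) expr2 mulrA mulVf ?mul1r// gt_eqF ?sqrtr_gt0.
have sq (x : R) : x ^+ 2 <= 2 * (expR x + expR (- x)).
  wlog x0 : x / 0 <= x => [h|].
    have [|x0] := leP 0 x; first exact: h.
    have := h (- x); rewrite sqrrN opprK [X in 2 * X]addrC; apply.
    by rewrite oppr_ge0 ltW.
  have := expR_ge1Dxn 1 x0; have := expR_ge0 (- x).
  rewrite (_ : 2`! = 2)//; lra.
apply: (@le_trans _ _ (\int[P]_w (2 / n%:R *
    (expR (t * n%:R * quad_dev a w) + expR (- t * n%:R * quad_dev a w)))%:E))%E.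
  apply: ge0_le_integral => //.
  - by move=> w _; rewrite lee_fin sqr_ge0.
  - by apply/measurable_EFinP; exact: measurable_funX.
  - apply/measurable_EFinP; apply: measurable_funM => //.
    exact: measurable_funD.
  - move=> w _; rewrite lee_fin mulrAC ler_pdivlMr// mulNr tn mulNr.
    apply: le_trans (sq _); rewrite exprMn (sqr_sqrtr (ltW nR)).
    by rewrite mulrC lexx.
apply: le_trans (quad_dev_exp_le _ _ _ _) _ => //.
- rewrite ger0_norm ?invr_ge0//.
  rewrite lef_pV2 ?posrE ?sqrtr_gt0//.
  rewrite -[leLHS]ger0_norm// -sqrtr_sqr ler_wsqrtr// -natrX ler_nat.
  by [].
- rewrite lee_fin /t exprVn (sqr_sqrtr (ltW nR)) mulfK ?gt_eqF// mulr2n.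
  by rewrite le_eqVlt; apply/orP; left; apply/eqP; field; rewrite gt_eqF.
Qed.

End gaussian_sample.

(** * One graphical lasso step *)

Section glasso_minimizer.
Context {R : realType} {d : nat}.
Implicit Types (A B C L Psi : 'M[R]_d).

(** * Continuity of the loss, compactness and convexity *)

Section continuity_at.
Context {T : topologicalType} (x : T).
Implicit Types f g : T -> R.

Lemma cvg_sum_fun (I : Type) (r : seq I) (P : pred I) (f : I -> T -> R) :
  (forall i, f i y @[y --> x] --> f i x) ->
  \sum_(i <- r | P i) f i y @[y --> x] --> \sum_(i <- r | P i) f i x.
Proof. by move=> cf; apply: cvg_big => //; exact: add_continuous. Qed.

Lemma cvg_prod_fun (I : Type) (r : seq I) (P : pred I) (f : I -> T -> R) :
  (forall i, f i y @[y --> x] --> f i x) ->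
  \prod_(i <- r | P i) f i y @[y --> x] --> \prod_(i <- r | P i) f i x.
Proof. by move=> cf; apply: cvg_big => //; exact: mul_continuous. Qed.

Lemma cvgD_fun f g : f y @[y --> x] --> f x -> g y @[y --> x] --> g x ->
  f y + g y @[y --> x] --> f x + g x.
Proof. exact: cvgD. Qed.

Lemma cvgB_fun f g : f y @[y --> x] --> f x -> g y @[y --> x] --> g x ->
  f y - g y @[y --> x] --> f x - g x.
Proof. exact: cvgB. Qed.

Lemma cvgM_fun f g : f y @[y --> x] --> f x -> g y @[y --> x] --> g x ->
  f y * g y @[y --> x] --> f x * g x.
Proof. exact: cvgM. Qed.

Lemma cvgMl_fun (c : R) f : f y @[y --> x] --> f x ->
  c * f y @[y --> x] --> c * f x.
Proof. by apply: cvgM; exact: cvg_cst. Qed.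

Lemma cvgMr_fun (c : R) f : f y @[y --> x] --> f x ->
  f y * c @[y --> x] --> f x * c.
Proof. by move=> cf; apply: cvgM => //; exact: cvg_cst. Qed.

Lemma cvgBr_fun (c : R) f : f y @[y --> x] --> f x ->
  f y - c @[y --> x] --> f x - c.
Proof. by move=> cf; apply: cvgB => //; exact: cvg_cst. Qed.

Lemma cvg_norm_fun f : f y @[y --> x] --> f x -> `|f y| @[y --> x] --> `|f x|.
Proof. exact: cvg_norm. Qed.

End continuity_at.

(** Matrices are treated as row vectors of length [d * d], the setting of the compactness criterion
    [rV_compact] and of the extreme value theorem [EVT_min_rV]. *)
Lemma vec_mx_entry_continuous (i j : 'I_d) :
  continuous (fun v : 'rV[R]_(d * d) => vec_mx v i j).
Proof.
have -> : (fun v : 'rV[R]_(d * d) => vec_mx v i j) =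
    (fun v => v 0 (mxvec_index i j)).
  by apply/funext => v; rewrite -[in RHS](vec_mxK v) mxvecE.
exact: coord_continuous.
Qed.

Lemma det_vec_mx_continuous : continuous (fun v : 'rV[R]_(d * d) => \det (vec_mx v)).
Proof.
move=> v; apply: cvg_sum_fun => s; apply: cvgMl_fun.
by apply: cvg_prod_fun => i; exact: vec_mx_entry_continuous.
Qed.

Lemma fro2B_vec_mx_continuous Psi :
  continuous (fun v : 'rV[R]_(d * d) => fro2 (vec_mx v - Psi)).
Proof.
move=> v.
have e (w : 'rV[R]_(d * d)) : fro2 (vec_mx w - Psi) =
    \sum_i \sum_j (vec_mx w i j - Psi i j) * (vec_mx w i j - Psi i j).
  by apply: eq_bigr => i _; apply: eq_bigr => j _; rewrite !mxE expr2.
rewrite /continuous_at e (eq_cvg _ _ e); do 2!apply: cvg_sum_fun => ?.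
have h i j : vec_mx w i j - Psi i j @[w --> v] --> vec_mx v i j - Psi i j.
  by apply: cvgBr_fun; exact: vec_mx_entry_continuous.
by apply: cvgM_fun.
Qed.

Lemma innerE A B : inner A B = \sum_i \sum_j A i j * B i j.
Proof.
rewrite /inner exchange_big; apply: eq_bigr => j _; rewrite mxE.
by apply: eq_bigr => i _; rewrite mxE.
Qed.

Lemma l1off_hadamardE L A : l1off_norm (hadamard L A) =
  \sum_i \sum_(j | j != i) `|L i j * A i j|.
Proof.
by apply: eq_bigr => i _; apply: eq_bigr => j _; rewrite mxE.
Qed.

Lemma glasso_loss_continuous C L (v : 'rV[R]_(d * d)) : posdef (vec_mx v) ->
  {for v, continuous (fun v : 'rV[R]_(d * d) => glasso_loss C L (vec_mx v))}.
Proof.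
move=> pv.
have e (w : 'rV[R]_(d * d)) : glasso_loss C L (vec_mx w) =
    \sum_i \sum_j vec_mx w i j * C i j - ln (\det (vec_mx w)) +
    \sum_i \sum_(j | j != i) `|L i j * vec_mx w i j|.
  by rewrite /glasso_loss innerE l1off_hadamardE.
rewrite /prop_for /continuous_at e (eq_cvg _ _ e).
apply: cvgD_fun; first apply: cvgB_fun.
- do 2!apply: cvg_sum_fun => ?; apply: cvgMr_fun.
  exact: vec_mx_entry_continuous.
- apply: (@continuous_comp _ _ _ (fun v : 'rV[R]_(d * d) => \det (vec_mx v)) (@ln R)).
    exact: det_vec_mx_continuous.
  by apply: continuous_ln; exact: posdef_det_gt0.
- do 2!apply: cvg_sum_fun => ?; apply: cvg_norm_fun.
  apply: cvgMl_fun.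
  exact: vec_mx_entry_continuous.
Qed.

Lemma sym_ball_compact Psi (r : R) : 0 <= r ->
  compact [set v : 'rV[R]_(d * d) |
    (vec_mx v)^T = vec_mx v /\ fro2 (vec_mx v - Psi) <= r ^+ 2].
Proof.
move=> r0.
pose K := [set v : 'rV[R]_(d * d) | forall i,
  `[(mxvec Psi) 0 i - r, (mxvec Psi) 0 i + r]%classic (v 0 i)].
apply: (@subclosed_compact _ _ K).
- have -> : [set v : 'rV[R]_(d * d) |
    (vec_mx v)^T = vec_mx v /\ fro2 (vec_mx v - Psi) <= r ^+ 2] =
    (\bigcap_(ij in [set: 'I_d * 'I_d])
      [set v | vec_mx v ij.1 ij.2 - vec_mx v ij.2 ij.1 <= 0]) `&`
    [set v | fro2 (vec_mx v - Psi) <= r ^+ 2].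
    apply/seteqP; split => v /= [sv fv]; split => //.
      move=> [i j] _ /=.
      by move/matrixP: (sv) => /(_ i j); rewrite [LHS]mxE => ->; rewrite subrr.
    apply/matrixP => i j; rewrite [LHS]mxE; apply/eqP; rewrite eq_le -subr_le0.
    by rewrite (sv (j, i) I) -[X in _ && X]subr_le0 (sv (i, j) I).
  apply: closedI.
    apply: closed_bigI => ij _.
    have cf : continuous (fun v : 'rV[R]_(d * d) =>
        vec_mx v ij.1 ij.2 - vec_mx v ij.2 ij.1).
      by move=> v; apply: cvgB_fun; exact: vec_mx_entry_continuous.
    by have /continuous_closedP/(_ [set x | x <= 0]) := cf; apply; exact: closed_le.
  have /continuous_closedP/(_ [set x | x <= r ^+ 2]) :=
    @fro2B_vec_mx_continuous Psi.
  by apply; exact: closed_le.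
- apply: (@rV_compact _ _ (fun i => `[(mxvec Psi) 0 i - r, (mxvec Psi) 0 i + r]%classic)).
  by move=> i; exact: segment_compact.
- move=> v [_ fv] k /=; rewrite in_itv/= -ler_distlC.
  case/mxvec_indexP: k => i j; rewrite mxvecE.
  have -> : v 0 (mxvec_index i j) = vec_mx v i j by rewrite -{1}(vec_mxK v) mxvecE.
  rewrite distrC -ler_sqr ?nnegrE// real_normK ?num_real//.
  apply: le_trans fv; rewrite /fro2 (bigD1 i)//= (bigD1 j)//= !mxE.
  rewrite -addrA lerDl addr_ge0// sumr_ge0// => k _; rewrite ?sqr_ge0//.
  by apply: sumr_ge0 => l _; exact: sqr_ge0.
Qed.

(** The case [k = 0] of [ln_det_bregman], where any positive bound [b] on the form of [B] will do:
    concavity of the log-determinant. *)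
Lemma ln_det_tangent A B : posdef A -> posdef B ->
  ln (\det A) <= ln (\det B) + \tr (invmx B *m (A - B)).
Proof.
move=> pA pB; pose b := Num.sqrt (fro2 B) + 1.
have b0 : 0 < b by rewrite ltr_wpDl// sqrtr_ge0.
rewrite -lerBlDl -subr_le0 -(pmulr_rle0 _ (exprn_gt0 2 b0)).
apply: le_trans (ln_det_bregman (k := 0) _ (ltW b0) pA pB _ _) _.
- by rewrite lexx/= invr_ge0.
- move=> x; rewrite mulr0 mul0r.
  have [->|x0] := eqVneq x 0; last exact/ltW/posdef_qform.
  by rewrite /qform mulmx0 mxE.
- move=> x; apply: le_trans (ler_norm _) _; apply: le_trans (qform_fro_le _ _) _.
  by rewrite ler_wpM2r ?fro2_ge0// lerDl.
- by rewrite oppr0 mul0r.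
Qed.

Lemma posdef_segment A B (t : R) : 0 <= t <= 1 -> posdef A -> posdef B ->
  posdef ((1 - t) *: A + t *: B).
Proof.
move=> /andP[t0 t1] pA pB; have [[sA _] [sB _]] := (pA, pB).
split=> [|x x0]; first by rewrite linearD !linearZ/= sA sB.
rewrite -/(qform _ _) qformD !qformZ.
have := posdef_qform pA x0; have := posdef_qform pB x0.
have [->|tn0] := eqVneq t 0; first by rewrite subr0; lra.
have {}t0 : 0 < t by rewrite lt_neqAle eq_sym tn0.
move=> B0 A0; have : 0 < t * qform B x by rewrite mulr_gt0.
have : 0 <= (1 - t) * qform A x by rewrite mulr_ge0 ?(ltW A0)// subr_ge0.
lra.
Qed.

(** Both endpoints are compared with the tangent of [ln \det] at the intermediate point [G]; in the
    weighted sum the linear terms cancel ([tr0]). *)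
Lemma glasso_loss_convex C L A B (t : R) : 0 <= t <= 1 ->
  posdef A -> posdef B ->
  glasso_loss C L ((1 - t) *: A + t *: B) <=
  (1 - t) * glasso_loss C L A + t * glasso_loss C L B.
Proof.
move=> t01 pA pB; have pG := posdef_segment t01 pA pB.
case/andP: t01 => t0 t1; have t1' : 0 <= 1 - t by rewrite subr_ge0.
have hA := ler_wpM2l t1' (ln_det_tangent pA pG).
have hB := ler_wpM2l t0 (ln_det_tangent pB pG).
set G := _ + _ in pG hA hB *.
have tr0 : (1 - t) * \tr (invmx G *m (A - G)) + t * \tr (invmx G *m (B - G)) = 0.
  rewrite -!mxtraceZ -mxtraceD !scalemxAr -mulmxDr.
  rewrite (_ : _ + _ = 0) ?mulmx0 ?mxtrace0//.
  rewrite !scalerBr addrACA -/G -opprD -scalerDl subrK scale1r subrr//.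
have hl : l1off_norm (hadamard L G) <=
    (1 - t) * l1off_norm (hadamard L A) + t * l1off_norm (hadamard L B).
  rewrite !l1off_hadamardE !mulr_sumr -big_split; apply: ler_sum => i _ /=.
  rewrite !mulr_sumr -big_split; apply: ler_sum => j _ /=.
  rewrite !mxE mulrDr; apply: le_trans (ler_normD _ _) _.
  by rewrite lerD// mulrCA normrM ger0_norm.
have hi : inner G C = (1 - t) * inner A C + t * inner B C.
  rewrite /inner /G linearD !linearZ/= mulmxDl -!scalemxAl.
  by rewrite mxtraceD !mxtraceZ.
rewrite /glasso_loss hi; nra.
Qed.

(* Compactness gives a minimizer on the ball; by convexity it is global and
   every global minimizer lies in the ball. *)
Lemma argmin_glasso_loss_ball C L Psi (r : R) : posdef Psi -> 0 < r ->
  (forall A, A^T = A -> fro2 (A - Psi) <= r ^+ 2 -> posdef A) ->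
  (forall A, A^T = A -> fro2 (A - Psi) = r ^+ 2 ->
    glasso_loss C L Psi < glasso_loss C L A) ->
  posdef (argmin posdef (glasso_loss C L)) /\
  fro2 (argmin posdef (glasso_loss C L) - Psi) <= r ^+ 2.
Proof.
move=> pP r0 ballP sphere.
have sP : Psi^T = Psi by case: pP.
(* The segment from [Psi] to [B] meets the sphere at parameter [t]. Were the loss at [B] no larger
   than at [Psi], convexity would contradict the strict increase on the sphere. *)
have out B : posdef B -> r ^+ 2 < fro2 (B - Psi) ->
    glasso_loss C L Psi < glasso_loss C L B.
  move=> pB rB; have B0 : 0 < fro2 (B - Psi) by rewrite (le_lt_trans _ rB)// sqr_ge0.
  pose t := r / Num.sqrt (fro2 (B - Psi)).
  have sB0 : 0 < Num.sqrt (fro2 (B - Psi)) by rewrite sqrtr_gt0.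
  have t0 : 0 < t by rewrite divr_gt0.
  have t1 : t < 1.
    rewrite ltr_pdivrMr// mul1r -ltr_sqr ?nnegrE ?(ltW r0) ?sqrtr_ge0//.
    by rewrite sqr_sqrtr ?fro2_ge0.
  have t01 : 0 <= t <= 1 by rewrite !ltW.
  have := glasso_loss_convex C L t01 pP pB.
  have pG := posdef_segment t01 pP pB.
  have : glasso_loss C L Psi < glasso_loss C L ((1 - t) *: Psi + t *: B).
    apply: sphere; first by case: pG.
    have -> : (1 - t) *: Psi + t *: B - Psi = t *: (B - Psi).
      by rewrite scalerBl scale1r scalerBr addrAC [_ - Psi]addrAC subrr add0r addrC.
    by rewrite fro2Z /t exprMn exprVn sqr_sqrtr ?fro2_ge0// divfK// gt_eqF.
  move=> h1 h2; rewrite -(ltr_pM2l t0); lra.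
pose K := [set v : 'rV[R]_(d * d) |
    (vec_mx v)^T = vec_mx v /\ fro2 (vec_mx v - Psi) <= r ^+ 2].
have KP : K (mxvec Psi).
  rewrite /K /= mxvecK; split=> //.
  by rewrite subrr (eqP (_ : fro2 0 == 0)) ?fro2_eq0// sqr_ge0.
have [|v vK vmin] := @EVT_min_rV R (d * d)
    (fun v => glasso_loss C L (vec_mx v)) K (ex_intro _ _ KP)
    (@sym_ball_compact Psi r (ltW r0)).
  apply: continuous_in_subspaceT => v /set_mem[sv fv].
  exact/glasso_loss_continuous/ballP.
move/set_mem: vK => -[sv fv].
(* Either [argmin] is a true minimizer, which [out] puts in the ball, or there is none; the second
   case is refuted by the minimizer [vec_mx v] over the ball, so the default 0 never occurs. *)
rewrite /argmin; case: xgetP => [A _ [pA Amin]|/(_ (vec_mx v))[]].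
- split=> //; rewrite leNgt; apply/negP => /(out _ pA).
  by rewrite ltNge Amin.
- split=> [|B pB]; first exact: ballP.
  have [rB|rB] := leP (fro2 (B - Psi)) (r ^+ 2).
    rewrite -[in leRHS](mxvecK B); apply: vmin; apply/mem_set.
    by rewrite /K /= mxvecK; split=> //; case: pB.
  apply: le_trans (ltW (out _ pB rB)).
  by rewrite -[in leRHS](mxvecK Psi); apply: vmin; apply/mem_set.
Qed.

(** This is [ln_det_bregman] with [k = 1/8], whose condition [4 k A <= Psi] then reads
    [A - Psi <= Psi]. The diagonal drops out of the linear part since [C] and [invmx Psi] agree
    there. *)
Lemma glasso_excess_ge C L A Psi (b : R) : posdef Psi -> posdef A -> 0 < b ->
  (forall x, qform Psi x <= b * fro2 x) ->
  (forall x, qform (A - Psi) x <= qform Psi x) ->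
  (forall i, C i i = invmx Psi i i) ->
  fro2 (A - Psi) / (8 * b ^+ 2) +
  \sum_i \sum_(j | j != i) ((A - Psi) i j * (C i j - invmx Psi i j)
     + (`|L i j * A i j| - `|L i j * Psi i j|))
  <= glasso_loss C L A - glasso_loss C L Psi.
Proof.
move=> pP pA b0 Pb AP2 Cd.
have := @ln_det_bregman _ _ 8^-1 b A Psi _ (ltW b0) pA pP _ Pb.
have k8 : 0 <= (8^-1 : R) <= 4^-1 by lra.
have h x : 4 * 8^-1 * qform A x <= qform Psi x.
  by have := AP2 x; rewrite qformB; lra.
move=> /(_ k8 h) {h}; rewrite mulrC -ler_pdivlMr ?exprn_gt0// => h.
have trE : \tr (invmx Psi *m (A - Psi)) =
    \sum_i \sum_j (A - Psi) i j * invmx Psi i j.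
  rewrite mxtrace_mulC exchange_big; apply: eq_bigr => i _.
  rewrite mxE; apply: eq_bigr => j _.
  rewrite -[in LHS](_ : (A - Psi)^T = A - Psi) ?mxE//.
  by rewrite linearB/=; case: pA pP => -> _ [-> _].
have sumE : \sum_i \sum_(j | j != i) ((A - Psi) i j * (C i j - invmx Psi i j)
     + (`|L i j * A i j| - `|L i j * Psi i j|)) =
   inner (A - Psi) C - \tr (invmx Psi *m (A - Psi)) +
   (l1off_norm (hadamard L A) - l1off_norm (hadamard L Psi)).
  rewrite innerE trE !l1off_hadamardE -!sumrB -big_split; apply: eq_bigr => i _ /=.
  rewrite -sumrB [X in _ = X + _](bigD1 i)//= Cd subrr add0r -sumrB -big_split.
  by apply: eq_bigr => j _ /=; rewrite mulrBr.
have iE : inner (A - Psi) C = inner A C - inner Psi C.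
  by rewrite /inner linearB/= mulmxBl raddfB.
rewrite sumE iE /glasso_loss.
have -> : fro2 (A - Psi) / (8 * b ^+ 2) = - (- 8^-1 * fro2 (A - Psi) / b ^+ 2).
  by field; rewrite gt_eqF.
lra.
Qed.

(** Entry by entry: [a] is the candidate, [p] the truth, [h] the noise, [l] the weight, [m] the
    entry of [D]. On the support the penalty changes by at most [l |a - p| <= m |a - p|]. Off it
    [p = 0], and the noise is absorbed by the penalty [l |a|] if [|h| <= l], and charged to [m]
    otherwise. *)
Lemma psi_step_term (a p h l m : R) (inS : bool) : 0 <= l -> 0 <= m ->
  (inS -> l <= m) -> (~~ inS -> p = 0 /\ (`|h| <= l \/ `|h| <= m)) ->
  - (((if inS then `|h| else 0) + m) * `|a - p|)
    <= (a - p) * h + (`|l * a| - `|l * p|).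
Proof.
move=> l0 m0 hS hN; rewrite !normrM (ger0_norm l0).
have hh : - (`|h| * `|a - p|) <= (a - p) * h.
  by rewrite mulrC -normrM lerNnormlW// lexx.
have a0 := normr_ge0 (a - p); have h0 := normr_ge0 h.
case: inS hS hN => [/(_ isT) lm _|_ /(_ isT)[p0 hlm]].
  have : `|p| <= `|a| + `|a - p|.
    by rewrite -{1}(subrK a p) distrC addrC (le_trans (ler_normD _ _))// addrC.
  have lma : l * `|a - p| <= m * `|a - p| by rewrite ler_wpM2r.
  move=> /(ler_wpM2l l0); rewrite mulrDr mulrDl; lra.
rewrite {}p0 subr0 in hh a0 *; rewrite normr0 mulr0 subr0 add0r.
case: hlm => hm.
  have : `|h| * `|a| <= l * `|a| by rewrite ler_wpM2r.
  have : 0 <= m * `|a| by rewrite mulr_ge0.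
  by lra.
have : `|h| * `|a| <= m * `|a| by rewrite ler_wpM2r.
have : 0 <= l * `|a| by rewrite mulr_ge0.
by lra.
Qed.

(* One step of the iteration: the new error is at most the noise restricted to
   [S] plus the matrix [D] that dominates the residual penalty on [S] and
   the noise at the entries off [S] that are penalized too little. *)
Lemma glasso_step C L Psi (S : {set 'I_d * 'I_d}) (D : 'M[R]_d) (b e : R) :
  posdef Psi -> 0 < b ->
  (forall x, qform Psi x <= b * fro2 x) -> (forall x, e * fro2 x <= qform Psi x) ->
  (forall i, C i i = invmx Psi i i) ->
  (forall i j, 0 <= D i j) -> (forall i j, j != i -> 0 <= L i j) ->
  (forall i j, (i, j) \in S -> L i j <= D i j) ->
  (forall i j, j != i -> (i, j) \notin S -> Psi i j = 0 /\
    (`|C i j - invmx Psi i j| <= L i j \/ `|C i j - invmx Psi i j| <= D i j)) ->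
  let r0 := 8 * b ^+ 2 * (Num.sqrt (\sum_(ij in S)
      (C ij.1 ij.2 - invmx Psi ij.1 ij.2) ^+ 2) + Num.sqrt (fro2 D)) in
  r0 < e ->
  posdef (argmin posdef (glasso_loss C L)) /\
  Num.sqrt (fro2 (argmin posdef (glasso_loss C L) - Psi)) <= r0.
Proof.
move=> pP b0 Pb Pe Cd D0 L0 LS LN r0 r0e.
have b2 : 0 < 8 * b ^+ 2 by rewrite mulr_gt0 ?exprn_gt0.
have r0ge : 0 <= r0 by rewrite mulr_ge0 ?addr_ge0 ?sqrtr_ge0// ltW.
pose HS : 'M[R]_d := \matrix_(i, j)
  (if (i, j) \in S then `|C i j - invmx Psi i j| else 0).
have HSE : fro2 HS = \sum_(ij in S) (C ij.1 ij.2 - invmx Psi ij.1 ij.2) ^+ 2.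
  rewrite /fro2 pair_big [RHS]big_mkcond; apply: eq_bigr => -[i j] _ /=.
  by rewrite mxE; case: ifP; rewrite ?expr0n// real_normK ?num_real.
rewrite -HSE in r0 r0e r0ge *.
(* Any radius strictly between [r0] and [e] works: above [r0] the quadratic term beats the linear
   ones on the sphere, and below [e] the ball stays positive definite with [A - Psi <= Psi]. The
   bound by [r0] itself follows by letting [r] decrease to it. *)
have main (r : R) : r0 < r -> r < e ->
    posdef (argmin posdef (glasso_loss C L)) /\
    fro2 (argmin posdef (glasso_loss C L) - Psi) <= r ^+ 2.
  move=> r0r re; have rgt0 : 0 < r := le_lt_trans r0ge r0r.
  have sq A x : fro2 (A - Psi) <= r ^+ 2 -> `|qform (A - Psi) x| <= r * fro2 x.
    move=> Ar; apply: le_trans (qform_fro_le _ _) _; rewrite ler_wpM2r ?fro2_ge0//.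
    by rewrite -[leRHS](ger0_norm (ltW rgt0)) -sqrtr_sqr ler_wsqrtr.
  have ballP A : A^T = A -> fro2 (A - Psi) <= r ^+ 2 -> posdef A.
    move=> sA Ar; split=> // x x0; rewrite -/(qform _ _).
    have := sq A x Ar; rewrite qformB ler_norml => /andP[h _].
    have x2 := fro2_gt0 x0; have := Pe x.
    have : r * fro2 x < e * fro2 x by rewrite ltr_pM2r.
    lra.
  apply: argmin_glasso_loss_ball => // A sA Ar.
  have pA : posdef A by apply: ballP; rewrite // Ar.
  rewrite -subr_gt0; apply: lt_le_trans (glasso_excess_ge L pP pA b0 Pb _ Cd).
    pose Z : 'M[R]_d := \matrix_(i, j) `|(A - Psi) i j|.
    have ZE : fro2 Z = r ^+ 2.
      rewrite -Ar; apply: eq_bigr => i _; apply: eq_bigr => j _.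
      by rewrite mxE real_normK ?num_real.
    have : - (\sum_i \sum_j HS i j * Z i j + \sum_i \sum_j D i j * Z i j) <=
      \sum_i \sum_(j | j != i) ((A - Psi) i j * (C i j - invmx Psi i j)
        + (`|L i j * A i j| - `|L i j * Psi i j|)).
      rewrite -big_split -sumrN; apply: ler_sum => i _ /=.
      rewrite -big_split -sumrN [leLHS](bigID (fun j => j != i))/=.
      rewrite -[leRHS]addr0 lerD//.
        apply: ler_sum => j ji /=; rewrite ![Z _ _]mxE [HS _ _]mxE !mxE -mulrDl.
        apply: psi_step_term => //; first exact: L0.
          exact: LS.
        exact: LN.
      rewrite sumrN oppr_le0; apply: sumr_ge0 => j _ /=.
      rewrite [Z _ _]mxE [HS _ _]mxE -mulrDl mulr_ge0// addr_ge0//.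
      by case: ifP.
    have := sum_mul_le_fro HS Z; have := sum_mul_le_fro D Z.
    rewrite ZE sqrtr_sqr (ger0_norm (ltW rgt0)) => h1 h2 h3.
    have h4 : (Num.sqrt (fro2 HS) + Num.sqrt (fro2 D)) * r < r ^+ 2 / (8 * b ^+ 2).
      rewrite expr2 mulrAC ltr_pM2r// ltr_pdivlMr// mulrC.
      exact: r0r.
    rewrite Ar; move: h4; rewrite mulrDl; lra.
  move=> x; have := sq A x; rewrite Ar lexx => /(_ isT).
  rewrite ler_norml => /andP[_ h]; apply: (le_trans h); apply: le_trans (Pe x).
  by rewrite ler_wpM2r ?fro2_ge0// ltW.
split.
  by have [||] := main ((r0 + e) / 2); [lra|lra|].
apply/ler_addgt0Pr => t t0.
pose r := Num.min (r0 + t) ((r0 + e) / 2).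
have [||_ h] := main r.
- by rewrite /r lt_min; apply/andP; split; lra.
- by rewrite /r gt_min; apply/orP; right; lra.
have r1 : r <= r0 + t by rewrite /r ge_min lexx.
have r2 : 0 <= r by rewrite /r le_min; apply/andP; split; lra.
apply: le_trans r1.
by rewrite -[leRHS](ger0_norm r2) -sqrtr_sqr ler_wsqrtr.
Qed.

End glasso_minimizer.

(** * Contraction under reweighting *)

(** [64 / 7] is the fixed point of [x = 8 + x / 8], the sum of the noise contributions [8], [8 / 8],
    and so on. *)
Lemma geometric_step (R : realFieldType) (u x y z : R) : 0 <= u ->
  x <= 8 * u + y / 8 -> y <= 64 / 7 * u + z -> x <= 64 / 7 * u + z / 8.
Proof. lra. Qed.

Section iteration.
Context {R : realType} {d : nat}.
Variables (Sigma C : 'M[R]_d) (w : R -> R) (alpha lambda e h rs : R).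
Local Notation Psi := (psi_star Sigma).
Local Notation b := (spectral_norm Psi).
Local Notation c := (c_const Sigma).
Local Notation S := (off_support (theta_star Sigma)).
Local Notation err l := (Num.sqrt (fro2 (psi_hat w lambda C l - Psi))).

Lemma c_const_ge : 64 * b ^+ 2 + 2 <= c.
Proof.
rewrite /c_const mulrDr mulrA; have : 1 <= Num.max (linf_norm Sigma ^+ 2) 1.
  by rewrite le_max lexx orbT.
lra.
Qed.

Lemma c_const_gt0 : 0 < c.
Proof. by have := c_const_ge; have := sqr_ge0 b; lra. Qed.

Hypotheses (l0 : 0 < lambda) (pP : posdef Psi) (b0 : 0 < b).
Hypothesis (Pe : forall x, e * fro2 x <= qform Psi x).
Hypothesis (Cd : forall i, C i i = invmx Psi i i).
Hypothesis (PS : forall i j, j != i -> (i, j) \notin S -> Psi i j = 0).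
Hypothesis (HC : forall i j, j != i -> `|C i j - invmx Psi i j| <= lambda / 2).
Hypothesis (a2 : assumption2 alpha lambda w Sigma).
Hypothesis (a3 : assumption3 alpha lambda Sigma).
Hypothesis (hS : Num.sqrt (\sum_(ij in S)
  (C ij.1 ij.2 - invmx Psi ij.1 ij.2) ^+ 2) <= h).
Hypothesis (rsS : Num.sqrt #|S|%:R <= rs).
Hypothesis (hrs : h <= lambda / 2 * rs).
Hypothesis (small : 12 * b ^+ 2 * lambda * rs < e).

(** [dl] stands for the previous error. The first bound contracts because [8 b^2 / c <= 1/8]. The
    second is the invariant that lets the step be repeated: it gives [|D|_F <= lambda rs], so the
    radius is at most [8 b^2 (1/2 + 1) lambda rs], which is the quantity in [small]. *)
Lemma psi_step_error (L D : 'M[R]_d) (dl : R) :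
  (forall i j, 0 <= D i j) -> (forall i j, j != i -> 0 <= L i j) ->
  (forall i j, (i, j) \in S -> L i j <= D i j) ->
  (forall i j, j != i -> (i, j) \notin S -> lambda / 2 <= L i j \/ lambda / 2 <= D i j) ->
  Num.sqrt (fro2 D) <= dl / c -> dl <= c * lambda * rs ->
  Num.sqrt (fro2 (argmin posdef (glasso_loss C L) - Psi))
    <= 8 * b ^+ 2 * h + dl / 8 /\
  Num.sqrt (fro2 (argmin posdef (glasso_loss C L) - Psi)) <= c * lambda * rs.
Proof.
move=> D0 L0 LS LN Ddl dlc; have c0 := c_const_gt0; have cb := c_const_ge.
have b8 : 0 < 8 * b ^+ 2 by rewrite mulr_gt0 ?exprn_gt0.
have rs0 : 0 <= rs := le_trans (sqrtr_ge0 _) rsS.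
have lrs : 0 <= lambda * rs by rewrite mulr_ge0// ltW.
have dl0 : 0 <= dl / c := le_trans (sqrtr_ge0 _) Ddl.
have dlE : dl = dl / c * c by rewrite divfK// gt_eqF.
have dlc' : dl / c <= lambda * rs by rewrite ler_pdivrMr// mulrC mulrA.
have HN i j : j != i -> (i, j) \notin S -> Psi i j = 0 /\
    (`|C i j - invmx Psi i j| <= L i j \/ `|C i j - invmx Psi i j| <= D i j).
  move=> ji ijS; split; first exact: PS.
  by have Hij := HC ji; have [lL|lD] := LN i j ji ijS;
    [left|right]; exact: le_trans Hij _.
have Hs : 8 * b ^+ 2 * (Num.sqrt (\sum_(ij in S)
    (C ij.1 ij.2 - invmx Psi ij.1 ij.2) ^+ 2) + Num.sqrt (fro2 D)) < e.
  apply: le_lt_trans small.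
  apply: (@le_trans _ _ (8 * b ^+ 2 * (lambda / 2 * rs + lambda * rs))).
    by rewrite ler_pM2l// lerD// ?(le_trans hS)// (le_trans Ddl).
  by rewrite le_eqVlt; apply/orP; left; apply/eqP; field.
have [_ h1] := glasso_step pP b0 (qform_le_spectral Psi) Pe Cd D0 L0 LS HN Hs.
have h2 : 8 * b ^+ 2 * (Num.sqrt (\sum_(ij in S)
      (C ij.1 ij.2 - invmx Psi ij.1 ij.2) ^+ 2) + Num.sqrt (fro2 D)) <=
    8 * b ^+ 2 * (h + dl / c) by rewrite ler_pM2l// lerD.
have h3 : 8 * b ^+ 2 * (dl / c) <= dl / 8.
  have -> : dl / 8 = c / 8 * (dl / c) by field; rewrite gt_eqF.
  by rewrite ler_wpM2r//; lra.
have h4 : 8 * b ^+ 2 * (h + dl / c) <= 8 * b ^+ 2 * (lambda / 2 * rs + lambda * rs).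
  by rewrite ler_pM2l// lerD.
have h5 : 8 * b ^+ 2 * (lambda / 2 * rs + lambda * rs) <= c * lambda * rs.
  have -> : 8 * b ^+ 2 * (lambda / 2 * rs + lambda * rs) =
    12 * b ^+ 2 * (lambda * rs) by field.
  rewrite -(mulrA c) ler_wpM2r//; have := sqr_ge0 b; lra.
split; last by rewrite (le_trans h1)// (le_trans h2)// (le_trans h4).
by apply: (le_trans h1); apply: (le_trans h2); rewrite mulrDr; lra.
Qed.

(** The start 0 need not be close to [Psi], so [D] cannot come from a previous error. All weights
    equal [lambda], and [D] is [lambda] on [S]; its norm is the one that a previous error
    [c lambda rs] would allow. *)
Lemma psi_hat1_error :
  err 1 <= 8 * b ^+ 2 * h + c * lambda * rs / 8 /\ err 1 <= c * lambda * rs.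
Proof.
have [wmono w01 w1 walpha wu] := a2; have c0 := c_const_gt0.
have l2 : lambda / 2 <= lambda.
  by rewrite ler_pdivrMr// ler_peMr ?(ltW l0)// ler1n.
have LE i j : j != i -> weights w lambda (psi_hat w lambda C 0) i j = lambda.
  by move=> ji; rewrite mxE eq_sym (negbTE ji) mxE normr0 w1// mulr1.
pose D : 'M[R]_d := \matrix_(i, j) (if (i, j) \in S then lambda else 0).
have DE : fro2 D = lambda ^+ 2 * #|S|%:R.
  rewrite /fro2 pair_big -sumr_const mulr_sumr [RHS]big_mkcond/=.
  apply: eq_bigr => -[i j] _ /=.
  by rewrite mxE; case: ifP; rewrite ?mulr1// expr0n.
have SE i j : (i, j) \in S -> j != i by rewrite inE eq_sym => /andP[].
apply: (@psi_step_error (weights w lambda (psi_hat w lambda C 0)) D).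
- by move=> i j; rewrite mxE; case: ifP => // _; exact: ltW.
- by move=> i j ji; rewrite LE// ltW.
- by move=> i j ijS; rewrite LE ?SE// mxE ijS.
- by move=> i j ji _; left; rewrite LE.
- rewrite DE sqrtrM ?sqr_ge0// sqrtr_sqr ger0_norm ?(ltW l0)//.
  by rewrite -(mulrA c) [c * _]mulrC mulfK ?gt_eqF// ler_pM2l.
- by [].
Qed.

Lemma psi_hatS_error l : err l.+1 <= c * lambda * rs ->
  err l.+2 <= 8 * b ^+ 2 * h + err l.+1 / 8 /\ err l.+2 <= c * lambda * rs.
Proof.
have [wmono w01 w1 walpha wu] := a2; have c0 := c_const_gt0.
move=> errl; set P := psi_hat w lambda C l.+1 in errl *.
have c0' : 0 <= c^-1 by rewrite invr_ge0 ltW.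
pose D : 'M[R]_d := \matrix_(i, j) (c^-1 * `|(P - Psi) i j|).
have SE i j : (i, j) \in S -> j != i by rewrite inE eq_sym => /andP[].
have LE i j : j != i -> weights w lambda P i j = lambda * w `|P i j|.
  by move=> ji; rewrite mxE eq_sym (negbTE ji).
have DE i j : D i j = c^-1 * `|P i j - Psi i j| by rewrite !mxE.
have w0 (x : R) : 0 <= w `|x| <= 1 by exact: w01.
have l2 : lambda / 2 <= lambda.
  by rewrite ler_pdivrMr// ler_peMr ?(ltW l0)// ler1n.
apply: (@psi_step_error (weights w lambda P) D) => //.
- by move=> i j; rewrite DE mulr_ge0.
- by move=> i j ji; rewrite LE// mulr_ge0 ?(ltW l0)//; case/andP: (w0 (P i j)).
- move=> i j ijS; rewrite LE ?SE// DE.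
  have [Pa|Pa] := leP (alpha * lambda) `|P i j|.
    apply: (@le_trans _ _ 0); last by rewrite mulr_ge0.
    by rewrite pmulr_rle0// -walpha; exact: wmono.
  apply: (@le_trans _ _ lambda).
    by rewrite ler_piMr ?(ltW l0)//; case/andP: (w0 (P i j)).
  rewrite ler_pdivlMl//; have := a3 ijS; rewrite mulrDl.
  have : `|Psi i j| <= `|P i j| + `|P i j - Psi i j|.
    by rewrite -{1}(subKr (P i j) (Psi i j)) (le_trans (ler_normB _ _)).
  lra.
- move=> i j ji ijS; rewrite LE// DE (PS ji ijS) subr0.
  have [Pc|Pc] := leP `|P i j| (c * lambda).
    left; rewrite mulrC [leRHS]mulrC ler_pM2r//.
    by apply: (le_trans wu); exact: wmono.
  by right; apply: (le_trans l2); rewrite ler_pdivlMl// ltW.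
- have -> : fro2 D = c^-1 ^+ 2 * fro2 (P - Psi).
    rewrite -fro2Z; apply: eq_bigr => i _; apply: eq_bigr => j _.
    by rewrite !mxE !exprMn real_normK ?num_real.
  by rewrite sqrtrM ?sqr_ge0// sqrtr_sqr ger0_norm// mulrC.
Qed.

Lemma psi_hat_error T : (0 < T)%N ->
  err T <= 64 / 7 * b ^+ 2 * h + c * lambda * rs / 8 ^+ T.
Proof.
case: T => // T _.
have h0 : 0 <= b ^+ 2 * h.
  by rewrite mulr_ge0 ?sqr_ge0// (le_trans _ hS)// sqrtr_ge0.
suff [] : err T.+1 <= 64 / 7 * b ^+ 2 * h + c * lambda * rs / 8 ^+ T.+1 /\
  err T.+1 <= c * lambda * rs by [].
elim: T => [|T [IH1 IH2]].
  by have [h1 h2] := psi_hat1_error; split=> //; rewrite expr1; lra.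
have [h1 h2] := psi_hatS_error IH2; split=> //.
have -> : c * lambda * rs / 8 ^+ T.+2 = c * lambda * rs / 8 ^+ T.+1 / 8.
  by rewrite exprSr invfM mulrA.
have IH1' := IH1; rewrite -(mulrA (64 / 7)) in IH1'.
rewrite -(mulrA (64 / 7)); apply: geometric_step h0 _ IH1'.
by rewrite mulrA.
Qed.

End iteration.

(** * Correlation matrices *)

Section correlation.
Context {R : realType} {d : nat}.
Implicit Types (A B Sigma : 'M[R]_d).

Lemma half_le_inv (p : R) : 2^-1 <= p -> 0 < p /\ p^-1 <= 2.
Proof.
move=> p2; have p0 : 0 < p by lra.
by split=> //; rewrite -[leRHS]invrK lef_pV2 ?posrE.
Qed.

Lemma invmx_uniq A B : A *m B = 1%:M -> invmx A = B.
Proof.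
move=> AB; have [uA _] := mulmx1_unit AB.
by rewrite -[LHS]mulmx1 -AB mulKmx.
Qed.

Definition istd_mx A : 'M[R]_d := diag_mx (\row_j (Num.sqrt (A j j))^-1).

Lemma std_mxK A : (forall i, 0 < A i i) -> std_mx A *m istd_mx A = 1%:M.
Proof.
move=> A0; apply/matrixP => i j; rewrite mul_diag_mx !mxE.
case: eqP => [->|_]; last by rewrite mulr0n mulr0.
by rewrite !mulr1n mulfV// gt_eqF// sqrtr_gt0.
Qed.

Lemma invmx_std A : (forall i, 0 < A i i) -> invmx (std_mx A) = istd_mx A.
Proof. by move=> /std_mxK/invmx_uniq. Qed.

Lemma corr_mxE A i j : (forall i, 0 < A i i) ->
  corr_mx A i j = A i j / (Num.sqrt (A i i) * Num.sqrt (A j j)).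
Proof.
move=> A0; rewrite /corr_mx invmx_std// mul_mx_diag mxE mul_diag_mx !mxE.
by rewrite invfM; ring.
Qed.

Lemma corr_mx_diag A i : (forall i, 0 < A i i) -> corr_mx A i i = 1.
Proof.
move=> A0; rewrite corr_mxE// -expr2 sqr_sqrtr ?ltW// divff// gt_eqF//.
Qed.

Lemma qform_delta A i : qform A (delta_mx i 0) = A i i.
Proof. by rewrite /qform trmx_delta -rowE -colE !mxE. Qed.

Lemma posdef_diag A i : posdef A -> 0 < A i i.
Proof.
move=> pA; rewrite -qform_delta; apply: posdef_qform => //.
apply/negP => /eqP/matrixP/(_ i 0); rewrite !mxE !eqxx => /eqP.
by rewrite oner_eq0.
Qed.

Lemma posdef_inv A : posdef A -> posdef (invmx A).
Proof.
move=> pA; have [L uL AE] := posdef_cholesky pA.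
rewrite (_ : invmx A = invmx L^T *m (invmx L^T)^T).
  by apply: gram_posdef; rewrite unitmx_inv unitmx_tr.
apply: invmx_uniq; rewrite trmx_inv trmxK AE mulmxA mulmxK ?unitmx_tr//.
by rewrite mulmxV.
Qed.

Lemma tr_diag_mx (v : 'rV[R]_d) : (diag_mx v)^T = diag_mx v.
Proof.
by apply/matrixP => i j; rewrite !mxE eq_sym; case: eqP => [->|].
Qed.

Variable Sigma : 'M[R]_d.
Hypothesis pS : posdef Sigma.
Let S0 i : 0 < Sigma i i := posdef_diag i pS.

Lemma istd_unit : istd_mx Sigma \in unitmx.
Proof. by have [] := mulmx1_unit (std_mxK S0). Qed.

Lemma posdef_corr : posdef (corr_mx Sigma).
Proof.
rewrite /corr_mx invmx_std// -[X in posdef (_ *m X)](tr_diag_mx (\row_j _)).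
exact: posdef_congr istd_unit pS.
Qed.

Lemma posdef_psi_star : posdef (psi_star Sigma).
Proof. exact: posdef_inv posdef_corr. Qed.

Lemma invmx_psi_star : invmx (psi_star Sigma) = corr_mx Sigma.
Proof. exact: invmxK. Qed.

Lemma psi_starE :
  psi_star Sigma = std_mx Sigma *m theta_star Sigma *m std_mx Sigma.
Proof.
have uS := posdef_unit pS.
apply: invmx_uniq; rewrite /corr_mx invmx_std//.
have h : istd_mx Sigma *m std_mx Sigma = 1%:M by apply: mulmx1C; exact: std_mxK.
rewrite /theta_star !mulmxA -(mulmxA (istd_mx Sigma *m Sigma)) h mulmx1.
by rewrite -(mulmxA (istd_mx Sigma)) mulmxV// mulmx1.
Qed.

Lemma theta_starE :
  theta_star Sigma = istd_mx Sigma *m psi_star Sigma *m istd_mx Sigma.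
Proof.
have h : istd_mx Sigma *m std_mx Sigma = 1%:M by apply: mulmx1C; exact: std_mxK.
by rewrite psi_starE !mulmxA h mul1mx -mulmxA std_mxK// mulmx1.
Qed.

Lemma psi_star_ij i j : psi_star Sigma i j =
  Num.sqrt (Sigma i i) * theta_star Sigma i j * Num.sqrt (Sigma j j).
Proof. by rewrite psi_starE mul_mx_diag mxE mul_diag_mx !mxE. Qed.

Lemma psi_star_off i j : j != i -> (i, j) \notin off_support (theta_star Sigma) ->
  psi_star Sigma i j = 0.
Proof.
move=> ji; rewrite inE eq_sym ji/= negbK => /eqP t0.
by rewrite psi_star_ij t0 mulr0 mul0r.
Qed.

(** The form is positive in the directions [e_i + e_j] and [e_i - e_j]. *)
Lemma corr_mx_le1 i j : i != j -> `|corr_mx Sigma i j| < 1.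
Proof.
move=> ij; have pC := posdef_corr; have [sC _] := pC.
have q (s : R) : qform (corr_mx Sigma) (delta_mx i 0 + s *: delta_mx j 0) =
    1 + 2 * s * corr_mx Sigma i j + s ^+ 2.
  rewrite qform_addZ// !qform_delta !corr_mx_diag// mulr1; congr (_ + _ * _ + _).
  by rewrite -[in RHS]sC [RHS]mxE trmx_delta -colE -rowE [LHS]mxE [LHS]mxE.
have n0 (s : R) : delta_mx i 0 + s *: delta_mx j 0 != 0 :> 'cV[R]_d.
  apply/negP => /eqP/matrixP/(_ i 0); rewrite !mxE !eqxx (negbTE ij) mulr0 addr0.
  by move/eqP; rewrite oner_eq0.
have := posdef_qform pC (n0 1); have := posdef_qform pC (n0 (-1)).
rewrite !q ltr_norml; lra.
Qed.

(** * Spectral bounds from the constants, and the rescaling to Theta *)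

Section bounds.
Variables (eps1 eps2 : R).
Hypotheses (d0 : (0 < d)%N).
Hypotheses (e1 : 0 < eps1) (e1min : eps1 <= sigma_min Sigma)
  (e1max : sigma_max Sigma <= eps1^-1).
Hypotheses (e2 : 0 < eps2) (e2min : eps2 <= lambda_min (theta_star Sigma))
  (e2max : lambda_max (theta_star Sigma) <= eps2^-1).

Lemma sqrt_diag_bounds i : eps1 <= Num.sqrt (Sigma i i) <= eps1^-1.
Proof.
apply/andP; split.
  apply: (le_trans e1min); rewrite ler_wsqrtr//; apply: ge_inf; last by exists i.
  by exists 0 => _ [j _ <-]; exact: ltW.
apply: le_trans e1max; rewrite ler_wsqrtr//; apply: ub_le_sup; last by exists i.
exists (\sum_j Sigma j j) => _ [j _ <-].
by rewrite (bigD1 j)//= lerDl sumr_ge0// => k _; exact: ltW.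
Qed.

Lemma std_fro2_bounds (x : 'cV[R]_d) :
  eps1 ^+ 2 * fro2 x <= fro2 (std_mx Sigma *m x) <= eps1^-1 ^+ 2 * fro2 x.
Proof.
rewrite /fro2 !mulr_sumr; apply/andP; split; apply: ler_sum => i _;
  rewrite !big_ord1 mul_diag_mx !mxE exprMn ler_wpM2r ?sqr_ge0//;
  rewrite ler_sqr ?nnegrE ?sqrtr_ge0 ?invr_ge0 ?(ltW e1)//;
  by case/andP: (sqrt_diag_bounds i).
Qed.

Lemma psi_star_qform x : qform (psi_star Sigma) x =
  qform (theta_star Sigma) (std_mx Sigma *m x).
Proof.
rewrite psi_starE -qform_congr /qform.
by rewrite (tr_diag_mx (\row_j Num.sqrt (Sigma j j))).
Qed.

Lemma theta_star_sym : (theta_star Sigma)^T = theta_star Sigma.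
Proof. by case: (posdef_inv pS). Qed.

Lemma psi_star_qform_ge x :
  eps2 * eps1 ^+ 2 * fro2 x <= qform (psi_star Sigma) x.
Proof.
rewrite psi_star_qform.
apply: le_trans (lambda_min_le_qform _ d0 theta_star_sym).
have /andP[h _] := std_fro2_bounds x; rewrite -mulrA.
apply: (@le_trans _ _ (eps2 * fro2 (std_mx Sigma *m x))).
  by rewrite ler_wpM2l// ltW.
by rewrite ler_wpM2r// fro2_ge0.
Qed.

Lemma psi_star_qform_le x :
  qform (psi_star Sigma) x <= eps2^-1 * eps1^-1 ^+ 2 * fro2 x.
Proof.
rewrite psi_star_qform.
apply: le_trans (qform_le_lambda_max _ d0 theta_star_sym) _.
have /andP[_ h] := std_fro2_bounds x; rewrite -mulrA.
apply: (@le_trans _ _ (eps2^-1 * fro2 (std_mx Sigma *m x))).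
  by rewrite ler_wpM2r// fro2_ge0.
by rewrite ler_wpM2l// invr_ge0 ltW.
Qed.

Lemma psi_star_spectral_le :
  spectral_norm (psi_star Sigma) <= eps2^-1 * eps1^-1 ^+ 2.
Proof.
apply: posdef_spectral_le psi_star_qform_le; last exact: posdef_psi_star.
by rewrite mulr_ge0 ?sqr_ge0 ?invr_ge0 ?(ltW e2).
Qed.

Lemma psi_star_spectral_gt0 : 0 < spectral_norm (psi_star Sigma).
Proof.
case: d d0 Sigma pS psi_star_qform_ge => // n _ T pT ge.
rewrite lt_neqAle spectral_norm_ge0 andbT; apply/negP => /eqP s0.
have := qform_le_spectral (psi_star T) (delta_mx 0 0); rewrite -s0 mul0r.
have := ge (delta_mx 0 0).
have -> : fro2 (delta_mx 0 0 : 'cV[R]_n.+1) = 1.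
  by rewrite fro2_vec trmx_delta mul_delta_mx mxE !eqxx.
have : 0 < eps2 * eps1 ^+ 2 by rewrite mulr_gt0// exprn_gt0.
lra.
Qed.

(** With inverse standard deviations [D1] (empirical) and [D0] (true), the error is [D1 (Ph - Psi)
    D1 + (D1 - D0) Psi D1 + D0 Psi (D1 - D0)]. Since [D1 <= 2 / eps1] and [|D1 - D0| <= 2 t / eps1],
    the constants are [4 = 2 * 2] and [6 = 2 * 2 + 2]. *)
Lemma plug_in_error (Shat Ph : 'M[R]_d) (t : R) : 0 <= t <= 2^-1 ->
  (forall i, `|Shat i i / Sigma i i - 1| <= t) ->
  spectral_norm (invmx (std_mx Shat) *m Ph *m invmx (std_mx Shat)
    - theta_star Sigma) <=
  4 * eps1^-1 ^+ 2 * Num.sqrt (fro2 (Ph - psi_star Sigma))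
    + 6 * (eps2^-1 * eps1^-1 ^+ 2) * eps1^-1 ^+ 2 * t.
Proof.
move=> /andP[t0 t2] St.
have ie1 : 0 <= eps1^-1 by rewrite invr_ge0 ltW.
have Spos i : 0 < Shat i i.
  have := St i; rewrite ler_norml => /andP[h _].
  have : 0 < Shat i i / Sigma i i by lra.
  by rewrite pmulr_lgt0// invr_gt0.
have ratio i : exists2 p, 2^-1 <= p & `|1 - p| <= t /\
    Num.sqrt (Shat i i) = Num.sqrt (Sigma i i) * p.
  have r0 : 0 <= Shat i i / Sigma i i by rewrite divr_ge0// ltW.
  exists (Num.sqrt (Shat i i / Sigma i i)).
    rewrite -[leLHS](@ger0_norm R)// -sqrtr_sqr ler_wsqrtr//.
    have := St i; rewrite ler_norml => /andP[h _]; lra.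
  split; last first.
    by rewrite -sqrtrM ?(ltW (S0 i))// mulrCA divff ?mulr1// gt_eqF.
  apply: le_trans (St i); rewrite -{2}(sqr_sqrtr r0) distrC.
  set p := Num.sqrt _; have p0 : 0 <= p by exact: sqrtr_ge0.
  have -> : p ^+ 2 - 1 = (p - 1) * (p + 1) by ring.
  by rewrite normrM ler_peMr// ger0_norm; lra.
have D0 : spectral_norm (istd_mx Sigma) <= eps1^-1.
  apply: spectral_norm_diag => // i; rewrite mxE ger0_norm ?invr_ge0 ?sqrtr_ge0//.
  by rewrite lef_pV2 ?posrE ?sqrtr_gt0//; case/andP: (sqrt_diag_bounds i).
have D0i i : (Num.sqrt (Sigma i i))^-1 <= eps1^-1.
  by rewrite lef_pV2 ?posrE ?sqrtr_gt0//; case/andP: (sqrt_diag_bounds i).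
have D1 : spectral_norm (istd_mx Shat) <= 2 * eps1^-1.
  apply: spectral_norm_diag => [|i]; first by rewrite mulr_ge0.
  rewrite mxE ger0_norm ?invr_ge0 ?sqrtr_ge0//.
  have [p /half_le_inv[p0 p2] [_ ->]] := ratio i.
  by rewrite invfM mulrC ler_pM ?invr_ge0 ?sqrtr_ge0 ?(ltW p0).
have D10 : spectral_norm (istd_mx Shat - istd_mx Sigma) <= 2 * t * eps1^-1.
  rewrite /istd_mx -linearB/=; apply: spectral_norm_diag => [|i].
    by rewrite !mulr_ge0.
  rewrite !mxE; have [p /half_le_inv[pgt0 p2] [pt ->]] := ratio i.
  have p0 : p != 0 by rewrite gt_eqF.
  have s0 : Num.sqrt (Sigma i i) != 0 by rewrite gt_eqF// sqrtr_gt0.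
  have -> : (Num.sqrt (Sigma i i) * p)^-1 - (Num.sqrt (Sigma i i))^-1 =
      p^-1 * (1 - p) * (Num.sqrt (Sigma i i))^-1 by field; rewrite p0 s0.
  rewrite !normrM ler_pM// ?mulr_ge0//; last first.
    by rewrite ger0_norm ?invr_ge0 ?sqrtr_ge0.
  by rewrite ler_pM// ger0_norm ?invr_ge0 ?(ltW pgt0).
rewrite !invmx_std// theta_starE.
have -> : istd_mx Shat *m Ph *m istd_mx Shat
    - istd_mx Sigma *m psi_star Sigma *m istd_mx Sigma =
  istd_mx Shat *m (Ph - psi_star Sigma) *m istd_mx Shat
  + ((istd_mx Shat - istd_mx Sigma) *m psi_star Sigma *m istd_mx Shat
  + istd_mx Sigma *m psi_star Sigma *m (istd_mx Shat - istd_mx Sigma)).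
  rewrite !(mulmxBl, mulmxBr); rewrite !addrA subrK; congr (_ - _).
  by rewrite subrK.
have n3 A B C a b c : spectral_norm A <= a -> spectral_norm B <= b ->
    spectral_norm C <= c -> spectral_norm (A *m B *m C) <= a * b * c.
  move=> Aa Bb Cc; apply: le_trans (spectral_normM _ _) _.
  rewrite ler_pM ?spectral_norm_ge0//; apply: le_trans (spectral_normM _ _) _.
  by rewrite ler_pM ?spectral_norm_ge0.
apply: le_trans (spectral_normD _ _) _.
have h1 := n3 _ _ _ _ _ _ D1 (spectral_norm_le_fro (Ph - psi_star Sigma)) D1.
have h2 := n3 _ _ _ _ _ _ D10 psi_star_spectral_le D1.
have h3 := n3 _ _ _ _ _ _ D0 psi_star_spectral_le D10.
have h4 := le_trans (spectral_normD _ _) (lerD h2 h3).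
apply: (le_trans (lerD h1 h4)).
by rewrite le_eqVlt; apply/orP; left; apply/eqP; ring.
Qed.

End bounds.
End correlation.

(** * Entrywise noise *)

Section correlation_error.
Context {R : realType} {d : nat}.
Variable Sigma : 'M[R]_d.
Hypothesis pS : posdef Sigma.
Let S0 i : 0 < Sigma i i := posdef_diag i pS.

Definition rel_dev (A : 'M[R]_d) (a : 'cV[R]_d) : R :=
  qform A a / qform Sigma a - 1.

(* Directions from which all the entries of a correlation matrix are recovered
   by polarization; the sign is irrelevant when i = j. *)
Definition polar_dir (k : 'I_d * 'I_d * bool) : 'cV[R]_d :=
  let: (i, j, s) := k in
  if i == j then delta_mx i 0
  else (Num.sqrt (Sigma i i))^-1 *: delta_mx i 0
       + ((-1) ^+ s * (Num.sqrt (Sigma j j))^-1) *: delta_mx j 0.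

Lemma polar_dir_neq0 k : polar_dir k != 0.
Proof.
case: k => -[i j] s; apply/negP => /eqP/matrixP/(_ i 0); rewrite /polar_dir.
case: eqP => [_|/eqP ij]; rewrite !mxE !eqxx; apply/eqP; first by rewrite oner_eq0.
by rewrite (negbTE ij) mulr0 addr0 mulr1 invr_eq0 gt_eqF// sqrtr_gt0.
Qed.

Lemma qform_polar_dir (A : 'M[R]_d) i j s : A^T = A -> i != j ->
  qform A (polar_dir (i, j, s)) = A i i / Sigma i i + A j j / Sigma j j +
    2 * (-1) ^+ s * (A i j / (Num.sqrt (Sigma i i) * Num.sqrt (Sigma j j))).
Proof.
move=> sA ij; rewrite /polar_dir (negbTE ij) qform_addZ// qformZv !qform_delta.
have -> : ((delta_mx j 0 : 'cV[R]_d)^T *m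
    (A *m ((Num.sqrt (Sigma i i))^-1 *: (delta_mx i 0 : 'cV[R]_d)))) 0 0
    = (Num.sqrt (Sigma i i))^-1 * A i j.
  rewrite -!scalemxAr mxE; congr (_ * _).
  by rewrite -[in RHS]sA [RHS]mxE trmx_delta -colE -rowE [LHS]mxE [LHS]mxE.
rewrite exprMn sqrr_sign mul1r !exprVn !sqr_sqrtr ?(ltW (S0 _))//.
rewrite invfM; ring.
Qed.

Lemma rel_dev_diag (A : 'M[R]_d) i s :
  rel_dev A (polar_dir (i, i, s)) = A i i / Sigma i i - 1.
Proof. by rewrite /rel_dev /polar_dir eqxx !qform_delta. Qed.

(** Write [c] for the correlation, [z] for the normalized entry of [A]. The form of [Sigma] in the
    two directions is [2 (1 + c)] and [2 (1 - c)]; subtracting cancels the diagonal terms and leaves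
    [z - c = (1 + c) / 2 * u2 - (1 - c) / 2 * u1], with weights at most 1. *)
Lemma normalized_entry_error (A : 'M[R]_d) i j : A^T = A -> i != j ->
  `|A i j / (Num.sqrt (Sigma i i) * Num.sqrt (Sigma j j)) - corr_mx Sigma i j|
  <= `|rel_dev A (polar_dir (i, j, false))| + `|rel_dev A (polar_dir (i, j, true))|.
Proof.
move=> sA ij; have [sS _] := pS.
have C1 := corr_mx_le1 pS ij; rewrite corr_mxE// in C1 *.
have vE s : qform Sigma (polar_dir (i, j, s)) =
    2 + 2 * (-1) ^+ s * (Sigma i j / (Num.sqrt (Sigma i i) * Num.sqrt (Sigma j j))).
  by rewrite qform_polar_dir// !divff ?gt_eqF.
have v0 s := posdef_qform pS (polar_dir_neq0 (i, j, s)).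
have dE s : qform Sigma (polar_dir (i, j, s)) * rel_dev A (polar_dir (i, j, s)) =
    qform A (polar_dir (i, j, s)) - qform Sigma (polar_dir (i, j, s)).
  by rewrite /rel_dev mulrBr mulr1 mulrC divfK// gt_eqF.
have := dE true; have := dE false.
rewrite !(qform_polar_dir _ sA ij) !vE.
move: (rel_dev _ _) (rel_dev _ _) => u1 u2.
move: (Sigma i j / _) C1 (A i j / _) (A i i / _ + A j j / _) => c C1 z m.
rewrite expr0 expr1 => h1 h2.
have -> : z - c = (1 + c) / 2 * u2 + - ((1 - c) / 2) * u1 by lra.
move: C1; rewrite ltr_norml => /andP[c1 c2].
apply: (le_trans (ler_normD _ _)).
rewrite [X in X + _]normrM [X in _ + X]normrM normrN.
apply: lerD; rewrite ler_piMl//; rewrite ger0_norm; lra.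
Qed.

(** [p q] lies between [p^2] and [q^2]. *)
Lemma geometric_mean_error (p q : R) : 0 <= p -> 0 <= q ->
  `|p * q - 1| <= `|p ^+ 2 - 1| + `|q ^+ 2 - 1|.
Proof.
wlog pq : p q / p <= q => [h p0 q0|p0 q0].
  have [pq|/ltW qp] := leP p q; first exact: h.
  by rewrite [p * q]mulrC [leRHS]addrC; apply: h.
have h1 : p ^+ 2 <= p * q by rewrite expr2 ler_wpM2l.
have h2 : p * q <= q ^+ 2 by rewrite expr2 ler_wpM2r.
have := ler_norm (q ^+ 2 - 1); have := ler_norm (- (p ^+ 2 - 1)); rewrite normrN.
have := normr_ge0 (p ^+ 2 - 1); have := normr_ge0 (q ^+ 2 - 1).
by move=> *; rewrite ler_norml; apply/andP; split; lra.
Qed.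

(** The error is [(p q)^-1 ((z - c) - c (p q - 1))], with [(p q)^-1 <= 2] and [|c| <= 1]. *)
Lemma ratio_error (z c p q : R) : `|c| <= 1 -> 2^-1 <= p ^+ 2 -> 2^-1 <= q ^+ 2 ->
  0 <= p -> 0 <= q ->
  `|z / (p * q) - c| <= 2 * (`|z - c| + (`|p ^+ 2 - 1| + `|q ^+ 2 - 1|)).
Proof.
move=> c1 p2 q2 p0 q0.
have pq2 : 2^-1 <= p * q.
  rewrite -ler_sqr ?nnegrE ?mulr_ge0// exprMn expr2.
  by rewrite ler_pM.
have [pq0 ipq] := half_le_inv pq2.
have -> : z / (p * q) - c = (p * q)^-1 * ((z - c) - c * (p * q - 1)).
  by field; move: pq0; rewrite lt_neqAle eq_sym mulf_eq0 negb_or => /andP[/andP[-> ->]].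
rewrite normrM ger0_norm ?invr_ge0 ?(ltW pq0)// ler_pM// ?invr_ge0 ?(ltW pq0)//.
apply: le_trans (ler_normB _ _) _; rewrite lerD// normrM.
by apply: le_trans (geometric_mean_error p0 q0); rewrite ler_piMl.
Qed.

Lemma corr_mx_error (A : 'M[R]_d) i j : A^T = A -> i != j ->
  (forall k, `|rel_dev A (polar_dir k)| <= 2^-1) ->
  `|corr_mx A i j - corr_mx Sigma i j| <=
  2 * (`|rel_dev A (polar_dir (i, j, false))| + `|rel_dev A (polar_dir (i, j, true))|
     + (`|rel_dev A (polar_dir (i, i, false))| + `|rel_dev A (polar_dir (j, j, false))|)).
Proof.
move=> sA ij dev.
have r2 k : 2^-1 <= A k k / Sigma k k.
  by have := dev (k, k, false); rewrite rel_dev_diag ler_norml => /andP[h _]; lra.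
have A0 k : 0 < A k k.
  by have [h _] := half_le_inv (r2 k); move: h; rewrite pmulr_lgt0// invr_gt0.
have r0 k : 0 <= A k k / Sigma k k by apply: le_trans (r2 k); rewrite invr_ge0.
have sE k : Num.sqrt (A k k) = Num.sqrt (Sigma k k) * Num.sqrt (A k k / Sigma k k).
  by rewrite -sqrtrM ?(ltW (S0 k))// mulrCA divff ?mulr1// gt_eqF.
have s0 k : Num.sqrt (Sigma k k) != 0 by rewrite gt_eqF// sqrtr_gt0.
rewrite (corr_mxE i j A0) (sE i) (sE j).
have -> : A i j / (Num.sqrt (Sigma i i) * Num.sqrt (A i i / Sigma i i)
      * (Num.sqrt (Sigma j j) * Num.sqrt (A j j / Sigma j j))) =
    A i j / (Num.sqrt (Sigma i i) * Num.sqrt (Sigma j j))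
      / (Num.sqrt (A i i / Sigma i i) * Num.sqrt (A j j / Sigma j j)).
  by rewrite mulrACA invfM mulrA.
apply: le_trans (ratio_error _ _ _ _ _ _) _; rewrite ?sqrtr_ge0 ?sqr_sqrtr//.
  exact/ltW/corr_mx_le1.
rewrite !rel_dev_diag ler_pM2l// lerD//.
exact: normalized_entry_error.
Qed.

Lemma sqr_sum4_le (a b c e x : R) : `|x| <= 2 * (a + b + (c + e)) ->
  x ^+ 2 <= 16 * (a ^+ 2 + b ^+ 2 + (c ^+ 2 + e ^+ 2)).
Proof.
move=> xle; rewrite -real_normK ?num_real//.
apply: (@le_trans _ _ ((2 * (a + b + (c + e))) ^+ 2)).
  by rewrite ler_sqr ?nnegrE// (le_trans _ xle).
have := sqr_ge0 (a - b); have := sqr_ge0 (a - c); have := sqr_ge0 (a - e).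
have := sqr_ge0 (b - c); have := sqr_ge0 (b - e); have := sqr_ge0 (c - e).
move: xle => _; nra.
Qed.

End correlation_error.

Section probability_bounds.
Context {R : realType} {disp : measure_display} {Omega : measurableType disp}.
Context (P : probability Omega R).

Lemma prob_bigsetU_le (I : Type) (r : seq I) (F : I -> set Omega) :
  (forall i, measurable (F i)) ->
  (P (\big[setU/set0]_(i <- r) F i) <= \sum_(i <- r) P (F i))%E.
Proof.
move=> mF; elim: r => [|i r IH]; first by rewrite !big_nil measure0.
rewrite !big_cons; apply: (le_trans (measureU2 _ _ _)) => //.
  by apply: bigsetU_measurable.
exact: leeD.
Qed.

Lemma integral_add_le (A B : R) (f g : Omega -> R) :
  measurable_fun [set: Omega] f -> measurable_fun [set: Omega] g ->
  (forall x, 0 <= f x) -> (forall x, 0 <= g x) ->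
  (\int[P]_x (f x)%:E <= A%:E)%E -> (\int[P]_x (g x)%:E <= B%:E)%E ->
  (\int[P]_x (f x + g x)%:E <= (A + B)%:E)%E.
Proof.
move=> mf mg f0 g0 fA gB.
have := integral_scale_add_le (@ler01 R) mf mg f0 g0 fA gB.
by rewrite mul1r; under eq_integral do rewrite mul1r.
Qed.

End probability_bounds.

Section good_event.
Context {R : realType} {disp : measure_display} {Omega : measurableType disp}.
Context (P : probability Omega R) {n d : nat}.
Variables (X : 'I_n -> 'I_d -> {RV P >-> R}) (Sigma : 'M[R]_d).
Hypotheses (pS : posdef Sigma) (iidX : iid_gaussian X Sigma).

Lemma sigma_hat_sym omega : (sigma_hat X omega)^T = sigma_hat X omega.
Proof.
rewrite /sigma_hat linearZ/= raddf_sum/=; congr (_ *: _).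
by apply: eq_bigr => i _; rewrite trmx_mul trmxK.
Qed.

Lemma rel_dev_sigma_hat a omega :
  rel_dev Sigma (sigma_hat X omega) a = quad_dev X Sigma a omega.
Proof.
rewrite /rel_dev /quad_dev /sigma_hat qformZ; congr (_ - 1).
rewrite -mulr_suml mulrA; congr (_ * _ / _).
rewrite /qform mulmx_sumr mulmx_suml summxE; apply: eq_bigr => i _.
rewrite -/(qform _ _) qform_outer; congr (_ ^+ 2).
by rewrite mxE; apply: eq_bigr => j _; rewrite !mxE mulrC.
Qed.

(** One event serves two norms of the same noise: [t] controls its maximum, through all [d * d * 2]
    polarization directions, and the free level [a] its sum of squares over [S]. *)
Lemma correlation_good_event (S : {set 'I_d * 'I_d}) (s : nat) (t a : R) :
  (forall i j, (i, j) \in S -> i != j) -> (#|S| <= s)%N ->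
  0 < t -> t <= 2^-1 -> (16 <= n)%N -> 0 < a ->
  exists B : set Omega, [/\ measurable B,
    (P B <= ((d * d * 2)%:R * (2 * expR (- (n%:R * t ^+ 2 / 16)))
             + 16 * expR 4 * s%:R / n%:R / a)%:E)%E &
    forall omega, ~ B omega ->
    [/\ forall i, `|sigma_hat X omega i i / Sigma i i - 1| <= t,
        forall i j, i != j ->
          `|corr_mx (sigma_hat X omega) i j - corr_mx Sigma i j| <= 8 * t &
        \sum_(ij in S) (corr_mx (sigma_hat X omega) ij.1 ij.2
                        - corr_mx Sigma ij.1 ij.2) ^+ 2 <= 16 * a]].
Proof.
move=> Sij Ss t0 t2 n16 a0; have n0 : (0 < n)%N by rewrite (leq_trans _ n16).
have nR : 0 < n%:R :> R by rewrite ltr0n.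
pose q k := quad_dev X Sigma (polar_dir Sigma k).
have mq k : measurable_fun [set: Omega] (q k) by exact: measurable_quad_dev.
pose B1 := \big[setU/set0]_(k : 'I_d * 'I_d * bool) [set w | (t <= `|q k w|)%R].
pose V w := \sum_(ij : 'I_d * 'I_d | ij \in S)
  (q (ij.1, ij.2, false) w ^+ 2 + q (ij.1, ij.2, true) w ^+ 2
  + (q (ij.1, ij.1, false) w ^+ 2 + q (ij.2, ij.2, false) w ^+ 2)).
have V0 w : 0 <= V w by apply: sumr_ge0 => ij _; rewrite !addr_ge0 ?sqr_ge0.
have mV : measurable_fun [set: Omega] V.
  rewrite /V; under eq_fun do rewrite -big_filter.
  apply: measurable_sum => ij.
  by do 2!apply: measurable_funD; apply: measurable_funX.
pose B2 := [set w | (a <= V w)%R].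
have mB1 : measurable B1.
  by apply: bigsetU_measurable => k _; exact: measurable_quad_dev_tail.
have mB2 : measurable B2.
  have -> : B2 = V @^-1` `[a, +oo[.
    by apply/seteqP; split => w /=; rewrite in_itv/= andbT.
  by rewrite -[X in measurable X]setTI; apply: mV.
exists (B1 `|` B2); split; first exact: measurableU.
- apply: (le_trans (measureU2 _ mB1 mB2)); rewrite EFinD; apply: leeD.
    apply: (@le_trans _ _ (\sum_(k : 'I_d * 'I_d * bool)
        P [set w | (t <= `|q k w|)%R])%E).
      by apply: prob_bigsetU_le => k; exact: measurable_quad_dev_tail.
    apply: (@le_trans _ _ (\sum_(k : 'I_d * 'I_d * bool)
        (2 * expR (- (n%:R * t ^+ 2 / 16)))%:E)%E).
      apply: lee_sum => k _; apply: quad_dev_tail => //.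
        exact: polar_dir_neq0.
      by rewrite t0/= (le_trans t2)//; lra.
    rewrite sumEFin sumr_const card_prod card_prod !card_ord card_bool.
    by rewrite [X in (_ <= X%:E)%E]mulr_natl lexx.
  (* Markov's inequality. Each index in [S] contributes four second moments of at most [4 e^4 / n],
     hence the constant 16. *)
  apply: (@le_trans _ _ (\int[P]_w (a^-1 * V w)%:E)%E).
    apply: prob_le_integral => //; first exact: measurable_funM.
      by move=> w; rewrite mulr_ge0// invr_ge0 ltW.
    by move=> w /= aV; rewrite ler_pdivlMl// mulr1.
  under eq_integral do rewrite EFinM.
  rewrite ge0_integralZl//; first last.
  - by rewrite lee_fin invr_ge0 ltW.
  - by move=> w _; rewrite lee_fin.
  - exact/measurable_EFinP.
  rewrite [X in (_ <= X%:E)%E]mulrC EFinM.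
  rewrite lee_wpmul2l ?lee_fin ?invr_ge0 ?(ltW a0)//.
  have m2 k : (\int[P]_w (q k w ^+ 2)%:E <= (4 * expR 4 / n%:R)%:E)%E.
    by apply: quad_dev_second_moment => //; exact: polar_dir_neq0.
  have mq2 k : measurable_fun [set: Omega] (fun w => q k w ^+ 2).
    exact: measurable_funX.
  rewrite /V; under eq_integral do rewrite -sumEFin -big_filter.
  rewrite ge0_integral_sum//; first last.
  - by move=> ij w _; rewrite lee_fin !addr_ge0 ?sqr_ge0.
  - move=> ij; apply/measurable_EFinP.
    by do 2!apply: measurable_funD.
  rewrite big_filter.
  apply: (@le_trans _ _ (\sum_(ij in S)
      (4 * expR 4 / n%:R + 4 * expR 4 / n%:R
       + (4 * expR 4 / n%:R + 4 * expR 4 / n%:R))%:E)%E).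
    apply: lee_sum => ij _.
    apply: integral_add_le; rewrite ?integral_add_le//.
    - exact: measurable_funD.
    - exact: measurable_funD.
    - by move=> w; rewrite addr_ge0 ?sqr_ge0.
    - by move=> w; rewrite addr_ge0 ?sqr_ge0.
    - by move=> w; rewrite sqr_ge0.
    - by move=> w; rewrite sqr_ge0.
    - by move=> w; rewrite sqr_ge0.
    - by move=> w; rewrite sqr_ge0.
  rewrite sumEFin sumr_const lee_fin -[leLHS]mulr_natl.
  rewrite [leRHS](_ : _ = s%:R * (4 * expR 4 / n%:R + 4 * expR 4 / n%:R
       + (4 * expR 4 / n%:R + 4 * expR 4 / n%:R))); last first.
    by field; rewrite gt_eqF.
  by rewrite ler_wpM2r ?ler_nat.
- move=> w /not_orP[nB1 nB2].
  have qt k : `|q k w| < t.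
    rewrite ltNge; apply/negP => tq; apply: nB1.
    by rewrite /B1 (bigD1 k)//=; left.
  have Va : V w <= a by rewrite leNgt; apply/negP => /ltW.
  have sS := sigma_hat_sym w.
  have dev k : `|rel_dev Sigma (sigma_hat X w) (polar_dir Sigma k)| <= 2^-1.
    by rewrite rel_dev_sigma_hat (le_trans (ltW (qt k))).
  split.
  + move=> i; rewrite -(@rel_dev_diag _ _ Sigma _ i false) rel_dev_sigma_hat.
    exact/ltW/qt.
  + move=> i j ij; apply: le_trans (corr_mx_error pS sS ij dev) _.
    rewrite !rel_dev_sigma_hat.
    rewrite [8 * t](_ : _ = 2 * (t + t + (t + t))); last by ring.
    by rewrite ler_pM2l// !lerD//; exact/ltW/qt.
  + apply: (@le_trans _ _ (16 * V w)); last by rewrite ler_pM2l.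
    rewrite /V mulr_sumr; apply: ler_sum => -[i j] ijS /=.
    have := corr_mx_error pS sS (Sij _ _ ijS) dev.
    rewrite !rel_dev_sigma_hat => /sqr_sum4_le.
    by rewrite !(real_normK (num_real _)).
Qed.

End good_event.

(** * The rate *)

Section nonasymptotic.
Context {R : realType} {disp : measure_display} {Omega : measurableType disp}.
Context (P : probability Omega R) {n d : nat}.

Lemma linf_norm_ge0 (A : 'M[R]_d) : 0 <= linf_norm A.
Proof. exact: bigmax_ge_id. Qed.

(** The event is taken at [t = lambda / 16], for which the entrywise error [8 t] is [lambda / 2],
    and at [a = kappa s / n]; [lambda <= 8] ensures [t <= 1/2]. *)
Lemma theta_tilde_good_event (M eps1 eps2 alpha lambda kappa : R) (s T : nat)
    (X : 'I_n -> 'I_d -> {RV P >-> R}) (Sigma : 'M[R]_d) (w : R -> R) :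
  let b := eps2^-1 * eps1^-1 ^+ 2 in
  posdef Sigma -> iid_gaussian X Sigma -> 0 < lambda -> (0 < s)%N ->
  assumption1 M eps1 eps2 s Sigma -> assumption2 alpha lambda w Sigma ->
  assumption3 alpha lambda Sigma -> (0 < d)%N -> (16 <= n)%N -> (0 < T)%N ->
  lambda <= 8 -> 12 * b ^+ 2 * (lambda * Num.sqrt s%:R) < eps2 * eps1 ^+ 2 ->
  0 < kappa ->
  exists B : set Omega, [/\ measurable B,
    (P B <= ((d * d * 2)%:R * (2 * expR (- (n%:R * (lambda / 16) ^+ 2 / 16)))
             + 16 * expR 4 / kappa)%:E)%E &
    forall omega, ~ B omega ->
      spectral_norm (theta_tilde w lambda (sigma_hat X omega) T - theta_star Sigma)
      <= 4 * eps1^-1 ^+ 2 *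
           (64 / 7 * b ^+ 2 * (4 * Num.sqrt kappa * Num.sqrt (s%:R / n%:R))
            + c_const Sigma * lambda * Num.sqrt s%:R / 8 ^+ T)
         + 6 * b * eps1^-1 ^+ 2 * (lambda / 16)].
Proof.
move=> b pS iidX l0 s0 [Ss SM [e1 e1min _ e1max] [e2 e2min _ e2max]] a2 a3 d0 n16 T0
  l8 small k0.
have nR : 0 < n%:R :> R by rewrite ltr0n (leq_trans _ n16).
have sR : 0 < s%:R :> R by rewrite ltr0n.
have b0 : 0 <= b by rewrite mulr_ge0 ?sqr_ge0 ?invr_ge0 ?(ltW e2).
have bge := psi_star_spectral_le pS d0 e1 e1min e1max e2 e2max.
have bgt := psi_star_spectral_gt0 pS d0 e1 e1min e1max e2 e2min.
have b2 : spectral_norm (psi_star Sigma) ^+ 2 <= b ^+ 2.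
  by rewrite ler_sqr ?nnegrE ?(ltW bgt).
have a0 : 0 < kappa * (s%:R / n%:R) by rewrite mulr_gt0 ?divr_gt0.
have t0 : 0 < lambda / 16 by rewrite divr_gt0.
have t2 : lambda / 16 <= 2^-1 by rewrite ler_pdivrMr// (le_trans l8)//; lra.
have SE i j : (i, j) \in off_support (theta_star Sigma) -> i != j.
  by rewrite inE => /andP[].
have [B [mB PB good]] := correlation_good_event pS iidX SE Ss t0 t2 n16 a0.
exists B; split=> //.
  apply: (le_trans PB); rewrite lee_fin lerD2l.
  by rewrite le_eqVlt; apply/orP; left; apply/eqP; field; rewrite !gt_eqF.
move=> omega /good[diag corr sumS] {good}.
set C := corr_mx (sigma_hat X omega) in corr sumS *.
have S0 i : 0 < Sigma i i := posdef_diag i pS.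
have h0 i : 0 < sigma_hat X omega i i.
  have := diag i; rewrite ler_norml => /andP[h _].
  have h2 : 0 < sigma_hat X omega i i / Sigma i i by lra.
  by move: h2; rewrite pmulr_lgt0// invr_gt0.
pose h := Num.sqrt (\sum_(ij in off_support (theta_star Sigma))
  (C ij.1 ij.2 - invmx (psi_star Sigma) ij.1 ij.2) ^+ 2).
have cl : 8 * (lambda / 16) = lambda / 2 by field.
have hle : h <= 4 * Num.sqrt kappa * Num.sqrt (s%:R / n%:R).
  rewrite /h invmx_psi_star// -[4](@ger0_norm R)// -sqrtr_sqr.
  rewrite -!sqrtrM ?mulr_ge0 ?sqr_ge0 ?(ltW k0)//.
  apply: ler_wsqrtr; apply: (le_trans sumS).
  by rewrite le_eqVlt; apply/orP; left; apply/eqP; ring.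
(* A second, cruder bound on [h], from the maximum norm: [hle] gives the rate, this one keeps each
   step inside the region where the loss is controlled. *)
have hrs : h <= lambda / 2 * Num.sqrt s%:R.
  rewrite /h invmx_psi_star// -[lambda / 2]ger0_norm ?divr_ge0 ?(ltW l0)//.
  rewrite -sqrtr_sqr -sqrtrM ?sqr_ge0//; apply: ler_wsqrtr.
  apply: (@le_trans _ _
      (\sum_(ij in off_support (theta_star Sigma)) (lambda / 2) ^+ 2)).
    apply: ler_sum => -[i j] ij /=; rewrite -real_normK ?num_real//.
    rewrite ler_sqr ?nnegrE ?divr_ge0 ?(ltW l0)// -cl.
    by apply: corr; exact: SE.
  by rewrite sumr_const -[leLHS]mulr_natr ler_wpM2l ?sqr_ge0// ler_nat.
have := @psi_hat_error R d Sigma C w alpha lambda (eps2 * eps1 ^+ 2) h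
  (Num.sqrt s%:R) l0 (posdef_psi_star pS) bgt.
move=> /(_ (psi_star_qform_ge pS d0 e1 e1min e1max e2 e2min)).
have Cd i : C i i = invmx (psi_star Sigma) i i.
  by rewrite invmx_psi_star// !corr_mx_diag.
have HC i j : j != i -> `|C i j - invmx (psi_star Sigma) i j| <= lambda / 2.
  by move=> ji; rewrite invmx_psi_star// -cl; apply: corr; rewrite eq_sym.
have rsS : Num.sqrt #|off_support (theta_star Sigma)|%:R <= Num.sqrt s%:R :> R.
  by rewrite ler_wsqrtr// ler_nat.
have small' : 12 * spectral_norm (psi_star Sigma) ^+ 2 * lambda * Num.sqrt s%:R
    < eps2 * eps1 ^+ 2.
  apply: le_lt_trans small; rewrite -(mulrA (12 * _)).
  by rewrite ler_wpM2r ?mulr_ge0 ?sqrtr_ge0 ?(ltW l0)// ler_pM2l.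
move=> /(_ Cd (psi_star_off pS) HC a2 a3 (lexx _) rsS hrs small' T T0) err.
have t01 : 0 <= lambda / 16 <= 2^-1 by rewrite (ltW t0).
apply: le_trans (plug_in_error pS d0 e1 e1min e1max e2 e2max
  (psi_hat w lambda C T) t01 diag) _.
apply: lerD => //; apply: ler_wpM2l; first by rewrite mulr_ge0 ?sqr_ge0.
apply: (le_trans err); apply: lerD => //; apply: ler_pM => //.
- by rewrite mulr_ge0 ?sqr_ge0 ?divr_ge0.
- exact: sqrtr_ge0.
- by rewrite ler_wpM2l// divr_ge0.
Qed.

Lemma c_const_le (M eps1 eps2 : R) (s : nat) (Sigma : 'M[R]_d) :
  posdef Sigma -> (0 < d)%N -> assumption1 M eps1 eps2 s Sigma ->
  c_const Sigma <=
    2 * (32 * (eps2^-1 * eps1^-1 ^+ 2) ^+ 2 + Num.max (M ^+ 2) 1).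
Proof.
move=> pS d0 [Ss SM [e1 e1min _ e1max] [e2 e2min _ e2max]].
have bge := psi_star_spectral_le pS d0 e1 e1min e1max e2 e2max.
rewrite /c_const ler_pM2l// lerD//.
  rewrite ler_pM2l// ler_sqr ?nnegrE ?spectral_norm_ge0//.
  exact: le_trans (spectral_norm_ge0 _) bge.
have M0 := le_trans (linf_norm_ge0 Sigma) SM.
rewrite ge_max !le_max lexx orbT andbT; apply/orP; left.
by rewrite ler_sqr ?nnegrE ?linf_norm_ge0.
Qed.

End nonasymptotic.

Section asymptotic_facts.
Context {R : realType}.

Lemma near_natr_gt (d : nat -> nat) (x : R) : d n @[n --> \oo] --> \oo ->
  \forall n \near \oo, x < (d n)%:R.
Proof.
move=> doo; near=> n; apply: (@lt_le_trans _ _ (Num.truncn x).+1%:R).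
  exact: truncnS_gt.
rewrite ler_nat; near: n.
exact: (doo _ (nbhs_infty_ge (Num.truncn x).+1)).
Unshelve. all: by end_near. Qed.

(** The constant 8 makes the exponent at least [8^2 / 16 * ln d = 4 ln d], so that the union over
    [2 d^2] directions leaves [4 / d^2]. *)
Lemma expR_tail_le (d n : nat) (u : R) : (0 < d)%N -> (0 < n)%N ->
  8 * Num.sqrt (ln d%:R / n%:R) <= u ->
  (d * d * 2)%:R * (2 * expR (- (n%:R * u ^+ 2 / 16))) <= 4 / d%:R :> R.
Proof.
move=> d0 n0 hu.
have dR : 0 < d%:R :> R by rewrite ltr0n.
have nR : 0 < n%:R :> R by rewrite ltr0n.
have lnd : 0 <= ln d%:R :> R by rewrite ln_ge0// ler1n.
have h : 4 * ln d%:R <= n%:R * u ^+ 2 / 16.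
  have s0 : 0 <= 8 * Num.sqrt (ln d%:R / n%:R) :> R by rewrite mulr_ge0 ?sqrtr_ge0.
  have := lerXn2r 2 s0 (le_trans s0 hu) hu.
  rewrite exprMn sqr_sqrtr ?divr_ge0 ?(ltW nR)// => h.
  have -> : 4 * ln d%:R = n%:R * (8 ^+ 2 * (ln d%:R / n%:R)) / 16 :> R.
    by field; rewrite gt_eqF.
  by rewrite ler_pM2r// ler_pM2l.
have e4 : expR (- (4 * ln d%:R)) = d%:R ^- 4 :> R.
  by rewrite expRN expRM_natl lnK ?posrE.
apply: (@le_trans _ _ ((d * d * 2)%:R * (2 * d%:R ^- 4))).
  by rewrite ler_wpM2l// ler_pM2l// -e4 ler_expR lerN2.
have -> : (d * d * 2)%:R * (2 * d%:R ^- 4) = 4 / d%:R * d%:R^-1 :> R.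
  by rewrite !natrM; field; rewrite gt_eqF.
by rewrite ler_piMr ?divr_ge0 ?(ltW dR)// invf_le1// ler1n.
Qed.

End asymptotic_facts.

Theorem theorem3p6 (R : realType) (M eps1 eps2 alpha : R) :
  exists2 A0 : R, 0 < A0 & forall A1 : R, A0 <= A1 ->
  exists2 kn : R, 0 < kn & exists2 kT : R, 0 < kT &
  forall (d s T : nat -> nat) (disp : nat -> measure_display)
    (Omega : forall n, measurableType (disp n))
    (P : forall n, probability (Omega n) R)
    (Sigma : forall n, 'M[R]_(d n))
    (X : forall n, 'I_n -> 'I_(d n) -> {RV (P n) >-> R})
    (w : nat -> R -> R) (lambda : nat -> R),
  d n @[n --> \oo] --> \oo ->
  (forall n, posdef (Sigma n)) ->
  (forall n, iid_gaussian (X n) (Sigma n)) ->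
  (forall n, 0 < lambda n) ->
  (forall n, (0 < s n)%N) ->
  (forall n, assumption1 M eps1 eps2 (s n) (Sigma n)) ->
  (forall n, assumption2 alpha (lambda n) (w n) (Sigma n)) ->
  (forall n, assumption3 alpha (lambda n) (Sigma n)) ->
  gtrsim_with kn (fun n => n%:R) (fun n => (s n)%:R * ln (d n)%:R) ->
  (\forall n \near \oo,
     A0 * Num.sqrt (ln (d n)%:R / n%:R) <= lambda n
       <= A1 * Num.sqrt (ln (d n)%:R / n%:R)) ->
  gtrsim_with kT (fun n => (T n)%:R)
    (fun n => ln (lambda n * Num.sqrt n%:R)) ->
  gtrsim (fun n => ln (lambda n * Num.sqrt n%:R))
    (fun n => ln (ln (d n)%:R)) ->
  bigO_prob P
    (fun n omega => spectral_norm
       (theta_tilde (w n) (lambda n) (sigma_hat (X n) omega) (T n)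
        - theta_star (Sigma n)))
    (fun n => Num.max (Num.sqrt ((s n)%:R / n%:R))
                      (Num.sqrt (ln (d n)%:R / n%:R))).
Proof.
(* The diagonal noise level lambda / 16 has to exceed 8 sqrt (ln d / n). *)
exists (8 * 16); first by rewrite mulr_gt0.
move=> A1 hA1; have A1gt0 : 0 < A1 by apply: lt_le_trans hA1; rewrite mulr_gt0.
(* Nonpositive [eps1] or [eps2] contradict assumption 1, so the constants may be arbitrary in these
   cases. *)
have [e1|e1] := leP eps1 0.
  exists 1 => //; exists 1 => // d s T ? ? ? Sigma ? ? ? ? _ _ _ _ a1.
  by have [_ _ [h _ _ _] _] := a1 0%N; move: h; rewrite ltNge e1.
have [e2|e2] := leP eps2 0.
  exists 1 => //; exists 1 => // d s T ? ? ? Sigma ? ? ? ? _ _ _ _ a1.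
  by have [_ _ _ [h _ _ _]] := a1 0%N; move: h; rewrite ltNge e2.
pose b := eps2^-1 * eps1^-1 ^+ 2.
pose e := eps2 * eps1 ^+ 2.
have b0 : 0 < b by rewrite mulr_gt0 ?exprn_gt0 ?invr_gt0.
have e0 : 0 < e by rewrite mulr_gt0 ?exprn_gt0.
(* [lambda sqrt s <= 1 / m] will give [12 b^2 lambda sqrt s < e], and also [lambda <= 8] since
   [m >= 1]. *)
pose m := 12 * b ^+ 2 / e + 1.
have m1 : 1 <= m by rewrite lerDr divr_ge0 ?(ltW e0)// mulr_ge0 ?sqr_ge0.
have m0 : 0 < m := lt_le_trans ltr01 m1.
have ln8 : 0 < ln 8 :> R by rewrite ln_gt0// ltr1n.
(* From [lambda <= A1 sqrt (ln d / n)], this sample size constant yields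
   [lambda sqrt s <= 1 / m]. *)
exists ((A1 * m) ^+ 2); first by rewrite exprn_gt0 ?mulr_gt0.
(* Each iteration divides the initial error by 8. *)
exists (ln 8)^-1; first by rewrite invr_gt0.
move=> d s T disp Omega P Sigma X w lambda doo pS iidX l0 s0 a1 a2 a3 hn hl hT.
move=> [k k0 hk].
move=> delta delta0.
(* Makes the Markov part [16 e^4 / kappa] equal to [delta / 2]; the other half covers [4 / d], small
   as [d] tends to infinity. *)
pose kappa := 32 * expR 4 / delta.
have kappa0 : 0 < kappa by rewrite divr_gt0 ?mulr_gt0 ?expR_gt0.
pose c := 2 * (32 * b ^+ 2 + Num.max (M ^+ 2) 1).
have c0 : 0 < c.
  have h : 0 < Num.max (M ^+ 2) 1 by rewrite lt_max ltr01 orbT.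
  by rewrite mulr_gt0// ltr_wpDl// mulr_ge0// sqr_ge0.
pose K := 4 * eps1^-1 ^+ 2 * (64 / 7 * b ^+ 2 * (4 * Num.sqrt kappa) + c)
  + 6 * b * eps1^-1 ^+ 2 * (A1 / 16).
have K1 : 0 <= 4 * eps1^-1 ^+ 2 by rewrite mulr_ge0 ?sqr_ge0.
have K2 : 0 <= 64 / 7 * b ^+ 2 by rewrite mulr_ge0 ?sqr_ge0// divr_ge0.
have K3 : 0 <= 6 * b * eps1^-1 ^+ 2.
  by apply: mulr_ge0; [apply: mulr_ge0 => //; exact: ltW|exact: sqr_ge0].
exists K.
  apply: ltr_wpDl.
    apply: mulr_ge0 => //; apply: addr_ge0; last exact: ltW.
    by apply: mulr_ge0 => //; rewrite mulr_ge0 ?sqrtr_ge0.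
  apply: mulr_gt0; last by rewrite divr_gt0.
  by apply: mulr_gt0; [exact: mulr_gt0|rewrite exprn_gt0 ?invr_gt0].
near=> n.
have n16 : (16 <= n)%N by near: n; exact: nbhs_infty_ge.
have n0 : (0 < n)%N := leq_trans (isT : (0 < 16)%N) n16.
have nR : 0 < n%:R :> R by rewrite ltr0n.
have de : expR 1 < (d n)%:R :> R by near: n; exact: near_natr_gt.
have dd : 8 / delta < (d n)%:R :> R by near: n; exact: near_natr_gt.
have hn' : (A1 * m) ^+ 2 * ((s n)%:R * ln (d n)%:R) <= n%:R by near: n; exact: hn.
have /andP[hl1 hl2] : 8 * 16 * Num.sqrt (ln (d n)%:R / n%:R) <= lambda n
       <= A1 * Num.sqrt (ln (d n)%:R / n%:R) by near: n; exact: hl.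
have hT' : (ln 8)^-1 * ln (lambda n * Num.sqrt n%:R) <= (T n)%:R :> R.
  by near: n; exact: hT.
have hk' : k * ln (ln (d n)%:R) <= ln (lambda n * Num.sqrt n%:R).
  by near: n; exact: hk.
have dR : 0 < (d n)%:R :> R by apply: le_lt_trans de; exact: expR_ge0.
have d0 : (0 < d n)%N by rewrite -(ltr0n R).
have lnd : 1 < ln (d n)%:R :> R by rewrite -[ltLHS]expRK ltr_ln ?posrE ?expR_gt0.
have lnd0 : 0 < ln (d n)%:R :> R := lt_trans ltr01 lnd.
(* The [log log d] condition forces [T] to be positive, so that at least one step is made. *)
have ln0 : 0 < ln (lambda n * Num.sqrt n%:R).
  by apply: lt_le_trans hk'; rewrite mulr_gt0// ln_gt0.
have T0 : (0 < T n)%N.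
  by rewrite -(ltr0n R); apply: lt_le_trans hT'; rewrite mulr_gt0// invr_gt0.
have sR : 1 <= (s n)%:R :> R by rewrite ler1n.
have sR0 : 0 < (s n)%:R :> R := lt_le_trans ltr01 sR.
have ls : lambda n * Num.sqrt (s n)%:R <= m^-1.
  apply: (@le_trans _ _ (A1 * Num.sqrt ((s n)%:R * ln (d n)%:R / n%:R))).
    rewrite [_ * ln _]mulrC mulrAC sqrtrM ?divr_ge0 ?(ltW lnd0) ?(ltW nR)//.
    by rewrite mulrA ler_wpM2r ?sqrtr_ge0.
  have -> : m^-1 = A1 * (A1 * m)^-1 by field; rewrite !gt_eqF.
  rewrite ler_pM2l// -[leRHS]ger0_norm ?invr_ge0 ?mulr_ge0 ?(ltW A1gt0) ?(ltW m0)//.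
  rewrite -sqrtr_sqr ler_wsqrtr// ler_pdivrMr// exprVn ler_pdivlMl//.
  by rewrite exprn_gt0// mulr_gt0.
have l8 : lambda n <= 8.
  apply: (@le_trans _ _ (lambda n * Num.sqrt (s n)%:R)).
    by rewrite ler_peMr ?(ltW (l0 n))// -[leLHS]sqrtr1 ler_wsqrtr.
  apply: (le_trans ls); apply: (@le_trans _ _ 1); last by rewrite ler1n.
  by rewrite invf_le1.
have small : 12 * b ^+ 2 * (lambda n * Num.sqrt (s n)%:R) < e.
  apply: (@le_lt_trans _ _ (12 * b ^+ 2 * m^-1)).
    by rewrite ler_wpM2l// mulr_ge0 ?sqr_ge0.
  rewrite ltr_pdivrMr//.
  have -> : e * m = 12 * b ^+ 2 + e by rewrite /m mulrDr mulr1 mulrC divfK ?gt_eqF.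
  by rewrite ltrDl.
have [B [mB PB good]] := theta_tilde_good_event (pS n) (iidX n) (l0 n) (s0 n) (a1 n)
  (a2 n) (a3 n) d0 n16 T0 l8 small kappa0.
exists B; split=> //.
  apply: (le_trans PB); rewrite lee_fin.
  have -> : delta = delta / 2 + delta / 2 by field.
  apply: lerD.
    have hl1' : 8 * Num.sqrt (ln (d n)%:R / n%:R) <= lambda n / 16.
      by rewrite ler_pdivlMr// mulrAC.
    apply: (le_trans (expR_tail_le d0 n0 hl1')).
    move: dd; rewrite ltr_pdivrMr// => dd; rewrite ler_pdivrMr//; lra.
  rewrite /kappa le_eqVlt; apply/orP; left; apply/eqP.
  by field; rewrite !gt_eqF// expR_gt0.
move=> omega /= Kom; apply: contrapT => /good {good} err.
set a := Num.max _ _ in Kom.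
have a0 : 0 < a by rewrite lt_max !sqrtr_gt0 !divr_gt0.
have as_ : Num.sqrt ((s n)%:R / n%:R) <= a by rewrite le_max lexx.
have al : Num.sqrt (ln (d n)%:R / n%:R) <= a by rewrite le_max lexx orbT.
move: Kom; rewrite ger0_norm ?divr_ge0 ?spectral_norm_ge0 ?(ltW a0)//.
rewrite ltr_pdivlMr// ltNge => /negP; apply; apply: (le_trans err).
rewrite -/b /K.
rewrite [leRHS]mulrDl.
apply: lerD; last first.
  rewrite -[leRHS]mulrA ler_wpM2l//.
  rewrite mulrAC ler_pM2r ?invr_gt0//; apply: (le_trans hl2).
  by rewrite ler_pM2l.
rewrite -[leRHS]mulrA ler_wpM2l// [leRHS]mulrDl; apply: lerD.
  by rewrite -[leRHS]mulrA ler_wpM2l// ler_wpM2l// mulr_ge0 ?sqrtr_ge0.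
apply: (@le_trans _ _ (c * Num.sqrt ((s n)%:R / n%:R))); last by rewrite ler_pM2l.
(* The number of iterations brings the initial error [c lambda sqrt s] below [c sqrt (s / n)]. *)
have T8 : lambda n * Num.sqrt n%:R <= 8 ^+ T n.
  have p0 : 0 < lambda n * Num.sqrt n%:R by rewrite mulr_gt0 ?sqrtr_gt0.
  rewrite -[leLHS]lnK ?posrE// -[8 in leRHS]lnK ?posrE// -expRM_natl ler_expR.
  by move: hT'; rewrite ler_pdivrMl// [ln 8 * _]mulrC.
have ccle := c_const_le (pS n) d0 (a1 n).
rewrite -[leLHS]mulrA -[leLHS]mulrA [X in _ * X <= _]mulrA; apply: ler_pM => //.
- exact/ltW/c_const_gt0.
- by rewrite !mulr_ge0 ?sqrtr_ge0 ?invr_ge0 ?exprn_ge0 ?(ltW (l0 n)).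
rewrite ler_pdivrMr ?exprn_gt0//.
have -> : lambda n * Num.sqrt (s n)%:R =
    Num.sqrt ((s n)%:R / n%:R) * (lambda n * Num.sqrt n%:R).
  by rewrite mulrCA -sqrtrM ?divr_ge0 ?(ltW nR) ?(ltW sR0)// divfK// gt_eqF.
by rewrite ler_wpM2l ?sqrtr_ge0.
Unshelve. all: by end_near. Qed.
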